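(* Let $n\ge2$, $S=\{z\in\mathbb{C}^n:|z|=1\}$, $r\in[0,1)$ and $\eta\in S$. The spherical harmonic expansion of the Poisson–Szegő kernel $\xi\mapsto P_n(r\xi,\eta)$, $\xi\in S$, has the form $$P_n(r\xi,\eta)=\frac{(1-r^2)^n}{|1-r(\xi\mid\eta)|^{2n}}=\sum_{p,q=0}^{\infty}\dim\mathcal{H}^{(p,q)}\;S_n^{p,q}(r)\;Z^{(p,q)}_\eta(\xi),$$ where $$S_n^{p,q}(r)=r^{p+q}\,\frac{(p+n-1)!\,(q+n-1)!}{(n-1)!\,(p-1)!\,(q-1)!}\sum_{k=0}^{\infty}\frac{(p+k-1)!\,(q+k-1)!}{(n-1+p+q+k)!}\,\frac{r^{2k}}{k!}$$ (where, when $p=0$ or $q=0$, the quotients $\frac{(p+k-1)!}{(p-1)!}$ and $\frac{(q+k-1)!}{(q-1)!}$ are understood as the Pochhammer symbols $(p)_k$ and $(q)_k$), or equivalently $$S_n^{p,q}(r)=r^{p+q}\;\frac{{}_2F_1(p,q;\,p+q+n;\,r^2)}{{}_2F_1(p,q;\,p+q+n;\,1)}.$$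
   Context: On $\mathbb{C}^n$, $(z\mid w)=\sum_{j=1}^n z_j\bar w_j$ and $|z|^2=(z\mid z)$. The Poisson–Szegő kernel is $P_n(z,\eta)=\frac{(1-|z|^2)^n}{|1-(z\mid\eta)|^{2n}}$ for $|z|<1$, $\eta\in S$. A polynomial $P(z,\bar z)$ on $\mathbb{C}^n$ is bihomogeneous of degree $(p,q)$ if $P(\lambda z,\bar\lambda\bar z)=\lambda^p\bar\lambda^qP(z,\bar z)$ for all $\lambda\in\mathbb{C}$. $\mathcal{H}^{(p,q)}$ is the space of harmonic polynomials on $\mathbb{C}^n$ (annihilated by $\Delta=4\sum_j\frac{\partial^2}{\partial z_j\partial\bar z_j}$) that are bihomogeneous of degree $(p,q)$, and $H^{(p,q)}$ is the space of their restrictions to $S$. One has $$\dim\mathcal{H}^{(p,q)}=\frac{(n+p+q-1)\,(n-2+p)!\,(n-2+q)!}{p!\,q!\,(n-1)!\,(n-2)!},$$ and $L^2(S,d\sigma)=\bigoplus_{p,q\ge0}H^{(p,q)}$ orthogonally, $\sigma$ being the normalized surface measure; the spherical harmonic expansion is the expansion with respect to this decomposition. Let $(r)_0=1$, $(r)_i=r(r+1)\cdots(r+i-1)$, and ${}_2F_1(a,b;c;t)=\sum_{j\ge0}\frac{(a)_j(b)_j}{(c)_j}\frac{t^j}{j!}$. The zonal kernel is $$Z^{(p,q)}_\eta(\xi)=\frac{(n-1)_{p+q}}{(n-1)_p\,(n-1)_q}\sum_{i=0}^{\min(p,q)}\frac{(-p)_i(-q)_i}{(-(n-2)-p-q)_i\,i!}\,(\xi\mid\eta)^{p-i}\,\overline{(\xi\mid\eta)}^{\,q-i},$$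 which lies in $H^{(p,q)}$ and satisfies $Z^{(p,q)}_\eta(\eta)=1$. *)

(* Defs.v *)
(* The notations of multinomials clash with those of MathComp-Analysis and are
   not imported. *)
From HB Require Import structures.
From mathcomp Require Import all_boot all_order all_algebra finmap.
From mathcomp.multinomials Require Import -(notations) mpoly.
From mathcomp Require Import complex.
From mathcomp Require Import all_classical all_reals all_analysis measurable_realfun.
From mathcomp.analysis.showcase Require Import summability.

Set Implicit Arguments.
Unset Strict Implicit.
Unset Printing Implicit Defensive.

Import Order.TTheory GRing.Theory Num.Theory.
Import numFieldNormedType.Exports.
Import Normc.

Local Open Scope classical_set_scope.
Local Open Scope ring_scope.
Local Open Scope complex_scope.

Notation Rn R m := (m.-tuple (measurableTypeR R)).

Section LebesgueRn.
Context {R : realType}.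

Definition Rn_cons m (x : measurableTypeR R * Rn R m) : Rn R m.+1 :=
  [tuple of x.1 :: x.2].

Definition Rn_uncons m (t : Rn R m.+1) : measurableTypeR R * Rn R m :=
  (thead t, [tuple of behead t]).

Lemma Rn_consK m : cancel (@Rn_cons m) (@Rn_uncons m).
Proof. by case=> x t; congr pair; apply/val_inj. Qed.

Lemma Rn_unconsK m : cancel (@Rn_uncons m) (@Rn_cons m).
Proof. by move=> t; rewrite /Rn_cons /= [RHS]tuple_eta. Qed.

Lemma measurable_Rn_cons m : measurable_fun setT (@Rn_cons m).
Proof. exact: measurable_cons. Qed.

Lemma measurable_Rn_uncons m : measurable_fun setT (@Rn_uncons m).
Proof.
apply: measurable_fun_pair; last exact: measurable_behead.
exact: measurable_tnth.
Qed.

Section step.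
Variables (m : nat) (mu : {sigma_finite_measure set (Rn R m) -> \bar R}).

Definition lebesgue_step : set (Rn R m.+1) -> \bar R :=
  pushforward (lebesgue_measure \x mu)%E (@Rn_cons m).

Let mcons := @measurable_Rn_cons m.

Let step0 : lebesgue_step set0 = 0%E. Proof. exact: measure0. Qed.

Let step_ge0 A : (0 <= lebesgue_step A)%E. Proof. exact: measure_ge0. Qed.

Let step_sigma_additive : semi_sigma_additive lebesgue_step.
Proof. exact: measure_semi_sigma_additive. Qed.

HB.instance Definition _ := isMeasure.Build _ _ _ lebesgue_step
  step0 step_ge0 step_sigma_additive.

Let step_sigma_finite : sigma_finite setT lebesgue_step.
Proof.
have /sigma_finiteP[F [TF ndF Foo]] :=
  sigma_finiteT (@lebesgue_measure R).
have /sigma_finiteP[G [TG ndG Goo]] := sigma_finiteT mu.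
exists (fun k => @Rn_uncons m @^-1` (F k `*` G k)).
  apply/esym; rewrite -subTset => t _.
  have [k _ Fk] : (\bigcup_i F i) (thead t) by rewrite -TF.
  have [l _ Gl] : (\bigcup_i G i) [tuple of behead t] by rewrite -TG.
  exists (maxn k l) => //; split.
    by have /subsetPset := ndF _ _ (leq_maxl k l); exact.
  by have /subsetPset := ndG _ _ (leq_maxr k l); exact.
move=> k; have [mF Fk] := Foo k; have [mG Gk] := Goo k; split.
  by rewrite -[X in measurable X]setTI; apply: measurable_Rn_uncons => //;
    exact: measurableX.
rewrite /lebesgue_step /pushforward -comp_preimage.
rewrite (_ : _ \o _ = id); last by apply/funext => x; exact: Rn_consK.
rewrite preimage_id product_measure1E// lte_mul_pinfty//.
by rewrite ge0_fin_numE.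
Qed.

HB.instance Definition _ := Measure_isSigmaFinite.Build _ _ _ lebesgue_step
  step_sigma_finite.
End step.

Fixpoint lebesgue_Rn (m : nat) : {sigma_finite_measure set (Rn R m) -> \bar R} :=
  match m with
  | 0 => \d_([tuple] : Rn R 0)
  | k.+1 => lebesgue_step (lebesgue_Rn k)
  end.

End LebesgueRn.

Section SurfaceMeasure.
Context {R : realType}.

Definition enorm m (t : Rn R m) : R := Num.sqrt (\sum_(i < m) tnth t i ^+ 2).

Definition uball m : set (Rn R m) := [set t | enorm t <= 1].

Definition radial_proj m (t : Rn R m) : Rn R m :=
  [tuple tnth t i / enorm t | i < m].

Lemma measurable_enorm m : measurable_fun setT (@enorm m).
Proof.
apply: (measurableT_comp (f := @Num.sqrt R)).
  exact: continuous_measurable_fun (@sqrt_continuous R).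
apply: measurable_sum => i.
by apply: measurable_funX; exact: measurable_tnth.
Qed.

Lemma measurable_uball m : measurable (@uball m).
Proof.
rewrite -[X in measurable X]setTI.
by apply: measurable_fun_le => //; exact: measurable_enorm.
Qed.

Lemma measurable_radial_proj m : measurable_fun setT (@radial_proj m).
Proof.
apply/measurable_fun_tnthP => i.
rewrite (_ : _ \o _ = (fun t => tnth t i * (enorm t)^-1)); last first.
  by apply/funext => t; rewrite /= tnth_mktuple.
apply: measurable_funM; first exact: measurable_tnth.
rewrite (_ : (fun t => _) = (@powR R ^~ (- 1)) \o @enorm m).
  apply: measurableT_comp; last exact: measurable_enorm.
  exact: measurable_powR.
by apply/funext => t /=; rewrite powR_inv1// sqrtr_ge0.
Qed.

Section pushed.
Variable m : nat.

(* A |-> volume of the cone { t : 0 < |t| <= 1, t / |t| \in A } *)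
Definition cone_volume : set (Rn R m) -> \bar R :=
  pushforward (mrestr (lebesgue_Rn m) (@measurable_uball m)) (@radial_proj m).

Let mproj := @measurable_radial_proj m.

Let cone0 : cone_volume set0 = 0%E. Proof. exact: measure0. Qed.

Let cone_ge0 A : (0 <= cone_volume A)%E. Proof. exact: measure_ge0. Qed.

Let cone_sigma_additive : semi_sigma_additive cone_volume.
Proof. exact: measure_semi_sigma_additive. Qed.

HB.instance Definition _ := isMeasure.Build _ _ _ cone_volume
  cone0 cone_ge0 cone_sigma_additive.

(* sigma A = vol (cone over A) / vol (unit ball), a probability on R^m
   concentrated on the unit sphere.  The total mass of [cone_volume] is the
   volume of the unit ball, which is neither 0 nor +oo, so the Dirac mass that
   [mnormalize] takes as a default value plays no role. *)
Definition surface_measure : probability (Rn R m) R :=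
  mnormalize cone_volume \d_([tuple of nseq m 0] : Rn R m).

End pushed.
End SurfaceMeasure.

Section Hermitian.
Context {R : realType}.
Local Notation C := R[i].

Definition hdot n (z w : 'rV[C]_n) : C := \sum_(j < n) z 0 j * (w 0 j)^*.

Definition hnorm n (z : 'rV[C]_n) : R := Num.sqrt (complex.Re (hdot z z)).

Definition usphere n : set 'rV[C]_n := [set z | hnorm z = 1].

Definition poisson_szego n (z eta : 'rV[C]_n) : R :=
  (1 - hnorm z ^+ 2) ^+ n / normc (1 - hdot z eta) ^+ (2 * n).

End Hermitian.

Section Dimension.
Context {K : fieldType} {E : lmodType K}.

Definition is_basis (V : set E) d (b : 'I_d -> E) : Prop :=
  [/\ forall i, V (b i),
      forall c : 'I_d -> K, \sum_(i < d) c i *: b i = 0 -> forall i, c i = 0 &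
      forall v, V v -> exists c : 'I_d -> K, v = \sum_(i < d) c i *: b i].

(* The dimension of a finite-dimensional linear subspace, and 0 otherwise. *)
Definition subspace_dim (V : set E) : nat :=
  xget 0%N [set d | exists b : 'I_d -> E, is_basis V b].

End Dimension.

Section SphericalHarmonics.
Context {R : realType}.
Local Notation C := R[i].

(* A polynomial P(z, zbar) on C^n is an element of C[X_0, ..., X_(2n-1)]:
   X_j stands for z_j and X_(n+j) for the conjugate of z_j. *)
Definition peval n (P : mpoly (n + n) C) (z : 'rV[C]_n) : C :=
  meval (fun k => match fintype.split k with
                  | inl j => z 0 j
                  | inr j => (z 0 j)^*
                  end) P.

Definition bihomogeneous n (p q : nat) (P : mpoly (n + n) C) : Prop :=
  forall (lam : C) (z : 'rV[C]_n),
    peval P (lam *: z) = lam ^+ p * lam^* ^+ q * peval P z.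

Definition laplacian n (P : mpoly (n + n) C) : mpoly (n + n) C :=
  4 *: \sum_(j < n) mderiv (lshift n j) (mderiv (rshift n j) P).

Definition calH n (p q : nat) : set (mpoly (n + n) C) :=
  [set P | bihomogeneous p q P /\ laplacian P = 0].

(* Elements of H^(p,q) are functions on the sphere; they are represented by
   functions on C^n whose values off the sphere are irrelevant. *)
Definition sphH n (p q : nat) : set ('rV[C]_n -> C) :=
  [set f | exists2 P, calH p q P & forall xi, usphere xi -> f xi = peval P xi].

Definition Cn_of_R2n n (t : Rn R (n + n)) : 'rV[C]_n :=
  \row_(j < n) Complex (tnth t (lshift n j)) (tnth t (rshift n j)).

Definition L2norm n (f : 'rV[C]_n -> C) : \bar R :=
  ('N[surface_measure (n + n)]_(2%:E) [(fun t => (normc (f (Cn_of_R2n t)))%:E)])%E.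

(* f = \sum_(p,q) F p q is the expansion of f with respect to the orthogonal
   decomposition of L^2(S) into the H^(p,q): each F p q is in H^(p,q) and the
   series converges to f in L^2(S), as an unordered sum (along the filter of
   finite sets of indices (p, q)). *)
Definition spherical_expansion n (f : 'rV[C]_n -> C)
    (F : nat * nat -> 'rV[C]_n -> C) : Prop :=
  (forall p q, sphH p q (F (p, q))) /\
  ((fun B : {fset nat * nat} => L2norm (fun xi => f xi - partial_sum (F ^~ xi) B))
    @ totally --> (0 : \bar R)%E).

(* Unordered, hence absolutely convergent, complex sums. *)
Definition has_sum (I : choiceType) (u : I -> C) (s : C) : Prop :=
  (fun B : {fset I} => normc (s - partial_sum u B)) @ totally --> (0 : R).

End SphericalHarmonics.

Definition pochhammer {K : pzRingType} (x : K) (i : nat) : K :=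
  \prod_(j < i) (x + j%:R).

Definition zonal {R : realType} n (p q : nat) (eta xi : 'rV[R[i]]_n) : R[i] :=
  pochhammer (n%:R - 1) (p + q)
    / (pochhammer (n%:R - 1) p * pochhammer (n%:R - 1) q)
  * \sum_(i < (minn p q).+1)
      pochhammer (- p%:R) i * pochhammer (- q%:R) i
        / (pochhammer (- (n%:R - 2) - p%:R - q%:R) i * i`!%:R)
      * hdot xi eta ^+ (p - i) * (hdot xi eta)^* ^+ (q - i).

Section RadialPart.
Context {R : realType}.

Definition hyp2F1_term (a b c t : R) (j : nat) : R :=
  pochhammer a j * pochhammer b j / pochhammer c j * (t ^+ j / j`!%:R).

Definition hyp2F1 (a b c t : R) : R := limn (series (hyp2F1_term a b c t)).

(* (p+k-1)! / (p-1)!, with the convention (0)_k when p = 0 *)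
Definition fact_quot (p k : nat) : R :=
  if p is 0 then pochhammer 0 k else (p + k - 1)`!%:R / (p - 1)`!%:R.

Definition Snpq_term n (p q : nat) (r : R) (k : nat) : R :=
  fact_quot p k * fact_quot q k / (n - 1 + p + q + k)`!%:R
  * (r ^+ (2 * k) / k`!%:R).

(* The factors 1/(p-1)! and 1/(q-1)! are kept inside the series, in the
   quotients [fact_quot], to which the convention for p = 0 or q = 0 applies. *)
Definition Snpq n (p q : nat) (r : R) : R :=
  r ^+ (p + q) * ((p + n - 1)`!%:R * (q + n - 1)`!%:R / (n - 1)`!%:R)
  * limn (series (Snpq_term n p q r)).

End RadialPart.

(* Main.v *)
(* Put a = n - 1, w = (xi | eta), v = conj w.  Up to an explicit factor Z^(p,q)
   is the coefficient of s^p t^q in (1 - s w - t v + s t)^(-a).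

   Dimension: the Laplacian maps bidegree (p+1, q+1) onto bidegree (p, q), so
   dim H^(p,q) is a difference of two numbers of monomials.

   Identity: by Euler's transformation (Pfaff-Saalschuetz on coefficients),
   S^(p,q)(r) = (1 - r^2)^n r^(p+q) sum_k e_k r^(2k) with explicit e_k >= 0, and
   the monomial w^a v^b is an explicit combination of the Z^(a-k,b-k); summing
   over k along the diagonals (p + k, q + k) = (a, b) turns the series into the
   product of the binomial series of (1 - r w)^(-n) and (1 - r v)^(-n).

   Convergence: multiplication by the Blaschke factor (v - s) / (1 - w s) is an
   l^2 contraction on truncated power series, which gives |Z^(p,q)| <= p + 1 for
   |w| <= 1.  For r < rho < 1 all remainders are then O((r / rho)^N), uniformly
   on the sphere; this gives both the pointwise and the L^2 convergence. *)
Require Import Defs.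
From HB Require Import structures.
From mathcomp Require Import all_boot all_order all_algebra finmap.
From mathcomp.multinomials Require Import -(notations) mpoly.
From mathcomp Require Import complex.
From mathcomp Require Import all_classical all_reals all_analysis.
From mathcomp.analysis.showcase Require Import summability.
From mathcomp Require Import measurable_realfun ring lra zify.

Set Implicit Arguments.
Unset Strict Implicit.
Unset Printing Implicit Defensive.

Import Order.TTheory GRing.Theory Num.Theory.
Import numFieldNormedType.Exports.
Import Normc.
Import HBNNSimple.

Local Open Scope classical_set_scope.
Local Open Scope ring_scope.
Local Open Scope complex_scope.

(** * Disk polynomials *)

(** The obstacle is that [S^(p,q)(r)] is itself an infinite series, so that summing along diagonals
    would rearrange a triple series. Only finite sums are rearranged: the product of the two
    binomial sums cut at [N] is exactly the sum over [p, q < N] in which the inner series is cut at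
    [k < N - maxn p q]. Every dropped term has [p + q + 2 k >= N]. Since the [e_k] are nonnegative,
    the inner series at [rho] controls the inner tails at [r], and it is bounded independently of
    [p] and [q] because the hypergeometric quotient stays in [[0, 1]]. The growth of the dimension
    and of the kernel bound is polynomial; it is paid for by raising the exponents of binomial
    series in [rho]. In the dimension count the obstacle is of another kind: bihomogeneity is a
    condition on values at the points [(z, conj z)], while counting needs exponents. The passage
    rests on the fact that a polynomial vanishing at all these points is zero. *)

Lemma pochhammer0 (K : pzRingType) (x : K) : pochhammer x 0 = 1.
Proof. by rewrite /pochhammer big_ord0. Qed.

Lemma pochhammerS (K : pzRingType) (x : K) k :
  pochhammer x k.+1 = pochhammer x k * (x + k%:R).
Proof. by rewrite /pochhammer big_ord_recr. Qed.

Lemma pochhammer_recl (K : pzRingType) (x : K) k :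
  pochhammer x k.+1 = x * pochhammer (x + 1) k.
Proof.
rewrite /pochhammer big_ord_recl addr0; congr (_ * _).
by apply: eq_bigr => j _; rewrite -addrA -nat1r.
Qed.

Lemma pochhammer_fact (K : comNzRingType) (a k : nat) :
  pochhammer a.+1%:R k * a`!%:R = (a + k)`!%:R :> K.
Proof.
elim: k => [|k IH]; first by rewrite pochhammer0 mul1r addn0.
rewrite pochhammerS mulrAC IH addnS factS -natrD -natrM.
by rewrite mulnC addSn.
Qed.

Lemma pochhammer_gt0 (K : numDomainType) (x : K) k :
  0 < x -> 0 < pochhammer x k.
Proof.
move=> x0; elim: k => [|k IH]; first by rewrite pochhammer0.
by rewrite pochhammerS mulr_gt0// ltr_pwDl.
Qed.

Lemma pochhammer_neg (K : comNzRingType) (p i : nat) :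
  pochhammer (- p%:R) i = (-1) ^+ i * (p ^_ i)%:R :> K.
Proof.
elim: i => [|i IH]; first by rewrite pochhammer0 mul1r.
rewrite pochhammerS IH ffactnSr natrM exprS.
have [ip|pi] := leqP i p; last by rewrite ffact_small// !(mulr0, mul0r).
by rewrite natrB//; ring.
Qed.

Lemma pochhammer_reflect (K : comNzRingType) (x : K) m i : (i <= m)%N ->
  pochhammer (1 - x - m%:R) i * (-1) ^+ i * pochhammer x (m - i) =
  pochhammer x m.
Proof.
elim: i => [|i IH] im; first by rewrite pochhammer0 !mul1r subn0.
rewrite -(IH (ltnW im)) pochhammerS -[(m - i)%N]prednK ?subn_gt0//.
rewrite -subnS [in RHS]pochhammerS natrB// -natr1 exprS; ring.
Qed.

Lemma big_triangle (V : nmodType) (F : nat -> nat -> V) m :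
  \sum_(k < m) \sum_(i < m - k) F k (k + i)%N =
  \sum_(j < m) \sum_(k < j.+1) F k j.
Proof.
elim: m => [|m IH]; first by rewrite !big_ord0.
rewrite [RHS]big_ord_recr/= -IH big_ord_recr/= subSnn big_ord1 addn0.
rewrite [X in _ = _ + X]big_ord_recr/= addrA; congr (_ + _).
rewrite -big_split/=; apply: eq_bigr => k _.
by rewrite subSn ?(ltnW (ltn_ord k))// big_ord_recr/= subnKC ?(ltnW (ltn_ord k)).
Qed.

Section DiskPolynomials.
Context {K : numFieldType} (al : nat) (al_gt0 : (0 < al)%N).
Implicit Types w v : K.

Let alpha : K := al%:R.

(** This is [p! q!] times the coefficient of [s^p t^q w^(p-i) v^(q-i)] in
    [(1 - s w - t v + s t)^(- al)]: the multinomial coefficient of [(s w + t v - s t)^m] for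
    [m = p + q - i], times [(al)_m / m!]. *)
Definition disk_coef (p q i : nat) : K :=
  (-1) ^+ i * pochhammer alpha (p + q - i) * ('C(p, i) * 'C(q, i) * i`!)%:R.

(* [disk (xi | eta) (eta | xi)] is the zonal kernel, see [zonalE]; [v] is kept
   independent of [w] because the identities below are polynomial in both. *)
Definition disk_sum w v p q : K :=
  \sum_(i < (minn p q).+1) disk_coef p q i * (w ^+ (p - i) * v ^+ (q - i)).

Definition disk w v p q : K :=
  disk_sum w v p q / (pochhammer alpha p * pochhammer alpha q).

Let alpha_gt0 : 0 < alpha. Proof. by rewrite ltr0n. Qed.

Let poch_neq0 k : pochhammer alpha k != 0.
Proof. by rewrite gt_eqF// pochhammer_gt0. Qed.

Lemma disk_coef_large p q i : (minn p q < i)%N -> disk_coef p q i = 0.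
Proof.
by rewrite /disk_coef gtn_min => /orP[] h; rewrite (bin_small h) ?muln0 !(mul0n, mulr0).
Qed.

Lemma disk_sum_wide w v p q N : (minn p q < N)%N ->
  disk_sum w v p q =
  \sum_(i < N) disk_coef p q i * (w ^+ (p - i) * v ^+ (q - i)).
Proof.
move=> pqN; rewrite /disk_sum (big_ord_widen _ (fun i => disk_coef p q i *
  (w ^+ (p - i) * v ^+ (q - i))) pqN).
rewrite [RHS](bigID (fun i : 'I_N => (i < (minn p q).+1)%N))/=.
rewrite [X in _ = _ + X]big1 ?addr0// => i; rewrite -leqNgt => h.
by rewrite disk_coef_large// mul0r.
Qed.

(** The recurrence [disk_sum_rec] read on the monomial [w^(k-i) v^(q-i)]. *)
Lemma disk_coef_rec k q i :
  disk_coef k.+1 q.+1 i.+1 - k.+1%:R * disk_coef k q.+1 i.+1 =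
  (alpha + q%:R) * (disk_coef k.+1 q i.+1 - k.+1%:R * disk_coef k q i).
Proof.
have [h|h] := ltnP (minn k q) i.
  by do 4 (rewrite disk_coef_large; last lia); ring.
have iq : (i <= q)%N by lia.
have ik : (i <= k)%N by lia.
rewrite /disk_coef.
have -> : (k.+1 + q.+1 - i.+1 = (k + q - i).+1)%N by lia.
have -> : (k + q.+1 - i.+1 = k + q - i)%N by lia.
have -> : (k.+1 + q - i.+1 = k + q - i)%N by lia.
rewrite pochhammerS natrB ?(leq_trans ik) ?leq_addr// natrD.
have bk : k.+1%:R * 'C(k, i.+1)%:R = (k%:R - i%:R) * 'C(k.+1, i.+1)%:R :> K.
  by rewrite -natrB// -!natrM mul_bin_down.
have bk' : k.+1%:R * 'C(k, i)%:R = i.+1%:R * 'C(k.+1, i.+1)%:R :> K.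
  by rewrite -!natrM mul_bin_diag.
have bq : 'C(q, i.+1)%:R = (q%:R - i%:R) * ('C(q.+1, i.+1)%:R / q.+1%:R) :> K.
  by rewrite mulrA -natrB// -!natrM -subSS -mul_bin_down natrM mulrAC mulfV ?mul1r// pnatr_eq0.
have bq' : 'C(q, i)%:R = i.+1%:R * ('C(q.+1, i.+1)%:R / q.+1%:R) :> K.
  by rewrite mulrA -!natrM -mul_bin_diag natrM mulrAC mulfV ?mul1r// pnatr_eq0.
have bq0 : 'C(q.+1, i.+1)%:R = q.+1%:R * ('C(q.+1, i.+1)%:R / q.+1%:R) :> K.
  by rewrite mulrC divfK// pnatr_eq0.
rewrite factS !natrM; set P := pochhammer _ _.
set X := 'C(k.+1, i.+1)%:R in bk bk' *.
set Y := _ / _ in bq bq' bq0; rewrite bq0 bq bq'.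
set A := 'C(k, i.+1)%:R in bk *; set B := 'C(k, i)%:R in bk' *.
rewrite exprS -[i.+1%:R]natr1 -[q.+1%:R]natr1 in bk' *.
apply/eqP; rewrite -subr_eq0; apply/eqP.
(* In the difference of the two sides [A] and [B] occur only multiplied by [k + 1], the form in
   which [bk] and [bk'] turn them into multiples of [X]. *)
transitivity (((-1) ^+ i * P * (q%:R + 1) * Y * i`!%:R * (i%:R + 1)) *
  ((k.+1%:R * A) - (alpha + k%:R + q%:R - i%:R) * X + (alpha + q%:R) * (q%:R - i%:R) / (q%:R+1) * X +
  (alpha + q%:R) / (q%:R + 1) * (k.+1%:R * B)));
  first by field; rewrite natr1 pnatr_eq0.
rewrite bk bk'; field; rewrite natr1 pnatr_eq0//.
Qed.


(** For [G = (1 - s w - t (v - s))^(- al)] this is the differential equation [(1 - s w - t (v - s))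
    dG/dt = al (v - s) G], compared coefficient by coefficient. *)
Lemma disk_sum_rec w v k q :
  disk_sum w v k.+1 q.+1 - k.+1%:R * w * disk_sum w v k q.+1 =
  (alpha + q%:R) * (v * disk_sum w v k.+1 q - k.+1%:R * disk_sum w v k q).
Proof.
pose N := (k + q).+1; pose m i := w ^+ (k - i) * v ^+ (q - i).
have hN : (minn k q < N)%N by rewrite /N; lia.
have E1 : disk_sum w v k.+1 q.+1 = disk_coef k.+1 q.+1 0 * (w ^+ k.+1 * v ^+ q.+1)
    + \sum_(i < N) disk_coef k.+1 q.+1 i.+1 * m i.
  by rewrite (@disk_sum_wide _ _ _ _ N.+1) 1?big_ord_recl//; lia.
have E2 : w * disk_sum w v k q.+1 = disk_coef k q.+1 0 * (w ^+ k.+1 * v ^+ q.+1)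
    + \sum_(i < N) disk_coef k q.+1 i.+1 * m i.
  rewrite (@disk_sum_wide _ _ _ _ N.+1) 1?big_ord_recl/=; last lia.
  rewrite mulrDr !subn0 [w ^+ k.+1]exprS; congr (_ + _); first by ring.
  rewrite mulr_sumr; apply: eq_bigr => i _; rewrite /m /bump/= add1n subSS.
  (* For [k <= i] the exponent [k - i.+1] truncates and the powers of [w] no longer match, but there
     the coefficient is zero. *)
  have [ik|ki] := ltnP i k; last by rewrite disk_coef_large ?(mul0r, mulr0)//; lia.
  by rewrite -[(k - i)%N]prednK ?subn_gt0// exprS -subnS; ring.
have E3 : v * disk_sum w v k.+1 q = disk_coef k.+1 q 0 * (w ^+ k.+1 * v ^+ q.+1)
    + \sum_(i < N) disk_coef k.+1 q i.+1 * m i.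
  rewrite (@disk_sum_wide _ _ _ _ N.+1) 1?big_ord_recl/=; last lia.
  rewrite mulrDr !subn0 [v ^+ q.+1]exprS; congr (_ + _); first by ring.
  rewrite mulr_sumr; apply: eq_bigr => i _; rewrite /m /bump/= add1n subSS.
  have [ik|ki] := ltnP i q; last by rewrite disk_coef_large ?(mul0r, mulr0)//; lia.
  by rewrite -[(q - i)%N]prednK ?subn_gt0// exprS -subnS; ring.
rewrite -mulrA E1 E2 E3 (@disk_sum_wide _ _ k q N)//.
have c0 : disk_coef k.+1 q.+1 0 - k.+1%:R * disk_coef k q.+1 0
    = (alpha + q%:R) * disk_coef k.+1 q 0.
  rewrite /disk_coef !bin0 !subn0 !addSn !addnS pochhammerS -addnS natrD; ring.
transitivity ((disk_coef k.+1 q.+1 0 - k.+1%:R * disk_coef k q.+1 0)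
    * (w ^+ k.+1 * v ^+ q.+1) + \sum_(i < N)
    (disk_coef k.+1 q.+1 i.+1 - k.+1%:R * disk_coef k q.+1 i.+1) * m i).
  rewrite mulrDr mulrBl opprD addrACA; congr (_ + _); first by ring.
  by rewrite mulr_sumr -sumrB; apply: eq_bigr => i _; ring.
rewrite c0 -addrA mulrDr; congr (_ + _); first by ring.
rewrite mulr_sumr -sumrB mulr_sumr; apply: eq_bigr => i _.
by rewrite disk_coef_rec /m; ring.
Qed.

Lemma disk_q0 w v k : disk w v k 0 = w ^+ k.
Proof.
rewrite /disk /disk_sum minn0 big_ord1 /disk_coef !bin0 !subn0 addn0 pochhammer0.
by rewrite expr0 fact0 expr0 !mulr1 mul1r mulrAC mulfV ?mul1r.
Qed.

Lemma disk_0q w v q : disk w v 0 q = v ^+ q.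
Proof.
rewrite /disk /disk_sum min0n big_ord1 /disk_coef !bin0 !subn0 add0n pochhammer0.
by rewrite expr0 fact0 expr0 !mulr1 !mul1r mulrAC mulfV ?mul1r.
Qed.

Lemma disk_rec w v k q :
  (alpha + k%:R) * disk w v k.+1 q.+1 - k.+1%:R * w * disk w v k q.+1 =
  (alpha + k%:R) * v * disk w v k.+1 q - k.+1%:R * disk w v k q.
Proof.
have ak0 j : alpha + j%:R != 0 by rewrite gt_eqF// ltr_pwDl.
have := disk_sum_rec w v k q; rewrite /disk !pochhammerS => /eqP.
rewrite subr_eq => /eqP ->.
by field; rewrite !ak0 !poch_neq0.
Qed.

(* The coefficient of z^k in (1 - z)^(- al). *)
Definition disk_gamma k : K := pochhammer alpha k / k`!%:R.

(** The row [R_q(s) = sum_k disk_gamma k * disk w v k q * s^k] is [(v - s)^q / (1 - w s)^(q + al)].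
    The lemma is the coefficient of [s^(k+1)] in [(1 - w s) R_(q+1) = (v - s) R_q]. *)
Lemma disk_blaschke w v k q :
  disk_gamma k.+1 * disk w v k.+1 q.+1 - w * (disk_gamma k * disk w v k q.+1) =
  v * (disk_gamma k.+1 * disk w v k.+1 q) - disk_gamma k * disk w v k q.
Proof.
have f0 : k`!%:R != 0 :> K by rewrite pnatr_eq0 -lt0n fact_gt0.
have := disk_rec w v k q; rewrite /disk_gamma pochhammerS factS natrM => /eqP.
rewrite subr_eq => /eqP h.
transitivity (pochhammer alpha k / (k.+1%:R * k`!%:R) * ((alpha + k%:R) *
  disk w v k.+1 q.+1 - k.+1%:R * w * disk w v k q.+1)).
  by field; rewrite f0 nat1r pnatr_eq0.
by rewrite h; field; rewrite f0 nat1r pnatr_eq0.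
Qed.

(** The reflection [(1 - al - m)_i (-1)^i (al)_(m-i) = (al)_m], for [m = p + q], clears the
    Pochhammer symbol in the denominator, and [(-p)_i (-q)_i / i!] supplies the binomials of
    [disk_coef]. *)
Lemma zonal_disk_sum w v p q :
  pochhammer alpha (p + q) / (pochhammer alpha p * pochhammer alpha q)
  * \sum_(i < (minn p q).+1)
      pochhammer (- p%:R) i * pochhammer (- q%:R) i
        / (pochhammer (1 - alpha - p%:R - q%:R) i * i`!%:R)
      * w ^+ (p - i) * v ^+ (q - i) = disk w v p q.
Proof.
rewrite /disk /disk_sum [RHS]mulrC mulrAC mulrC; congr (_ * _).
rewrite mulr_sumr; apply: eq_bigr => i _; rewrite !mulrA; congr (_ * _ * _).
have f0 : i`!%:R != 0 :> K by rewrite pnatr_eq0 -lt0n fact_gt0.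
have ipq : (i <= p + q)%N by have := ltn_ord i; lia.
have h := pochhammer_reflect alpha ipq.
rewrite -addrA -opprD -natrD -h !pochhammer_neg -!bin_ffact /disk_coef.
set A := pochhammer (_ - _) _ in h *.
have A0 : A != 0.
  by apply: contra (poch_neq0 (p + q)) => /eqP A0; rewrite -h A0 !mul0r.
(* [field] sees the sign as an atom. The left side carries it three times, twice from
   [pochhammer_neg] and once from the reflection, the right side only once. *)
have e3 : (-1) ^+ i = ((-1) ^+ i) ^+ 3 :> K.
  by rewrite -exprM mulnC exprM -[(-1) ^+ 3]signr_odd expr1.
by rewrite [in RHS]e3 !natrM; field; rewrite f0 A0.
Qed.

End DiskPolynomials.

(* Multiplication by the Blaschke factor [(w^* - s) / (1 - w s)] does not
   increase the l^2 norms of truncated power series in [s]; [H] is [s f / (1 - w s)],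
   and the matrix [[w^*, - c], [c, w]] with [c^2 = 1 - |w|^2] is unitary. *)
Lemma blaschke_contraction (C : numClosedFieldType) (w : C) (f g : nat -> C) :
  `|w| <= 1 -> g 0%N = w^* * f 0%N ->
  (forall k, g k.+1 - w * g k = w^* * f k.+1 - f k) ->
  forall p, \sum_(k < p) `|g k| ^+ 2 <= \sum_(k < p) `|f k| ^+ 2.
Proof.
move=> w1 g0 grec p.
pose H := fix H k := if k is j.+1 then f j + w * H j else 0.
have gE k : g k = w^* * f k - (1 - w * w^*) * H k.
  elim: k => [|k IH]; first by rewrite g0 mulr0 subr0.
  by have /eqP := grec k; rewrite subr_eq => /eqP ->; rewrite IH /=; ring.
have energy m : \sum_(k < m) `|g k| ^+ 2 + (1 - `|w| ^+ 2) * `|H m| ^+ 2 =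
    \sum_(k < m) `|f k| ^+ 2.
  elim: m => [|m IH]; first by rewrite !big_ord0 normr0 expr0n mulr0 addr0.
  rewrite !big_ord_recr/= -IH gE !normCK.
  by rewrite !(rmorphD, rmorphN, rmorphM, rmorph1)/= !conjCK; ring.
rewrite -(energy p) lerDl mulr_ge0 ?exprn_ge0//.
by rewrite subr_ge0 expr_le1.
Qed.

Lemma disk_gamma_gt0 (K : numFieldType) al k : (0 < al)%N ->
  0 < disk_gamma al k :> K.
Proof.
by move=> al0; rewrite divr_gt0 ?pochhammer_gt0 ?ltr0n ?fact_gt0.
Qed.

Lemma disk_gamma_le (K : numFieldType) al k l : (0 < al)%N -> (k <= l)%N ->
  disk_gamma al k <= disk_gamma al l :> K.
Proof.
move=> al0 /subnK <-; elim: (l - k)%N => [|m IH]//.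
apply: le_trans IH _; rewrite addSn /disk_gamma pochhammerS factS natrM invfM.
rewrite (mulrC _.+1%:R^-1) mulrACA ler_peMr//.
  by rewrite mulr_ge0// ltW ?invr_gt0 ?pochhammer_gt0 ?ltr0n ?fact_gt0.
by rewrite ler_pdivlMr ?ltr0n// mul1r -natrD ler_nat -add1n leq_add2r.
Qed.

(** The contraction leads from row [q] down to row [0], where the kernel is [w^k]. As [disk_gamma]
    is nondecreasing, the squares of that row up to [p] sum to at most [(p + 1) (disk_gamma p)^2],
    which bounds the last term of row [q]; the resulting square root of [p + 1] is weakened to
    [p + 1]. *)
Lemma disk_le (C : numClosedFieldType) (w : C) al p q : (0 < al)%N ->
  `|w| <= 1 -> `|disk al w w^* p q| <= p.+1%:R.
Proof.
move=> al0 w1; pose ga := @disk_gamma C al.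
have ga0 k : 0 <= ga k by rewrite ltW// disk_gamma_gt0.
have gp0 : 0 < ga p by exact: disk_gamma_gt0.
have row : \sum_(k < p.+1) `|ga k * disk al w w^* k q| ^+ 2 <=
    \sum_(k < p.+1) `|ga k * disk al w w^* k 0| ^+ 2.
  elim: q => [|q IH]//; apply: le_trans IH.
  apply: (@blaschke_contraction C w (fun k => ga k * disk al w w^* k q)
    (fun k => ga k * disk al w w^* k q.+1)) => //=.
    by rewrite !disk_0q// exprS; ring.
  by move=> k; rewrite disk_blaschke.
have : `|ga p * disk al w w^* p q| ^+ 2 <= p.+1%:R * ga p ^+ 2.
  apply: (@le_trans _ _ (\sum_(k < p.+1) `|ga k * disk al w w^* k q| ^+ 2)).
    by rewrite big_ord_recr/= lerDr sumr_ge0// => k _; rewrite exprn_ge0.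
  apply: le_trans row _.
  rewrite -[p.+1 in X in _ <= X]card_ord mulr_natl -sumr_const.
  apply: ler_sum => k _; rewrite disk_q0// normrM exprMn normrX (ger0_norm (ga0 _)).
  rewrite -[X in _ <= X]mulr1 ler_pM ?exprn_ge0 ?normr_ge0//.
    by rewrite lerXn2r ?nnegrE// disk_gamma_le// -ltnS.
  by rewrite !exprn_ile1 ?exprn_ge0.
rewrite normrM exprMn (ger0_norm (ga0 _)) mulrC ler_pM2r ?exprn_gt0// => h.
rewrite -(@ler_pXn2r _ 2) ?nnegrE//; apply: le_trans h _.
by rewrite -natrX ler_nat leq_pmulr.
Qed.

(** The factor [M - 2 k] makes the sum telescope: for [j > 0] the partial sum up to [m] is [(-1)^m
    'C(j - 1, m) (M - m - j - 1)! / (M - m - 1)!], which vanishes at [m = j]. The condition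
    [2 j < M] keeps the natural subtractions exact. *)
Lemma alt_factorial_sum (K : numFieldType) (M j : nat) : (2 * j < M)%N ->
  \sum_(k < j.+1) (-1) ^+ k * 'C(j, k)%:R * (M%:R - (2 * k)%:R) *
    (M - k - j - 1)`!%:R / (M - k)`!%:R = (j == 0%N)%:R :> K.
Proof.
case: j => [|j] jM.
  rewrite big_ord1 bin0 !mul1r !subn0 subr0.
  case: M jM => // M _; rewrite subn1/= factS natrM.
  by rewrite mulfV// -natrM pnatr_eq0 -lt0n muln_gt0 fact_gt0.
suff partial m : (m <= j.+1)%N ->
    \sum_(k < m.+1) (-1) ^+ k * 'C(j.+1, k)%:R * (M%:R - (2 * k)%:R) *
      (M - k - j.+1 - 1)`!%:R / (M - k)`!%:R =
    (-1) ^+ m * 'C(j, m)%:R * (M - m - j.+1 - 1)`!%:R / (M - m - 1)`!%:R :> K.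
  by rewrite partial// bin_small// mulr0 !mul0r.
elim: m => [|m IH] mj.
  rewrite big_ord1 !bin0 !mulr1 !mul1r !subn0 subr0.
  case: M jM => // M _; rewrite subn1/= subn1/= factS natrM.
  have f0 : M`!%:R != 0 :> K by rewrite pnatr_eq0 -lt0n fact_gt0.
  by field; rewrite f0 nat1r pnatr_eq0.
rewrite big_ord_recr/= IH ?(ltnW mj)//.
have -> : (M - m - j.+1 - 1 = (M - m.+1 - j.+1 - 1).+1)%N by lia.
have -> : (M - m - 1 = (M - m.+1 - 1).+1)%N by lia.
have -> : (M - m.+1 = (M - m.+1 - 1).+1)%N by lia.
have -> : ((M - m.+1 - 1).+1 - 1 = M - m.+1 - 1)%N by lia.
have -> : ((M - m.+1 - 1).+1 - j.+1 - 1 = M - m.+1 - j.+1 - 1)%N by lia.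
rewrite !factS !natrM.
have e1 : (M - m.+1 - j.+1 - 1).+1%:R = M%:R - m%:R - j%:R - 2%:R :> K.
  have -> : ((M - m.+1 - j.+1 - 1).+1 = M - (m + j + 2))%N by lia.
  by rewrite natrB; [rewrite !natrD; ring | lia].
have e2 : (M - m.+1 - 1).+1%:R = M%:R - m%:R - 1 :> K.
  have -> : ((M - m.+1 - 1).+1 = M - (m + 1))%N by lia.
  by rewrite natrB; [rewrite !natrD; ring | lia].
have b1 : 'C(j.+1, m.+1)%:R = 'C(j, m)%:R + 'C(j, m.+1)%:R :> K.
  by rewrite binS addnC natrD.
have b2 : m.+1%:R * 'C(j, m.+1)%:R = (j%:R - m%:R) * 'C(j, m)%:R :> K.
  by rewrite -natrB// -!natrM mul_bin_left.
have f0 : (M - m.+1 - 1)`!%:R != 0 :> K by rewrite pnatr_eq0 -lt0n fact_gt0.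
have e20 : M%:R - m%:R - 1 != 0 :> K by rewrite -e2 pnatr_eq0.
rewrite e1 e2 b1 exprS -[m.+1%:R]natr1 in b2 *.
set B := 'C(j, m.+1)%:R in b2 *; set A := 'C(j, m)%:R in b2 *.
set F := _`!%:R; set G := (M - m.+1 - 1)`!%:R in f0 *.
apply/eqP; rewrite -subr_eq0; apply/eqP.
transitivity ((-1) ^+ m * F / (G * (M%:R - m%:R - 1)) *
   ((m%:R + 1) * B - (j%:R - m%:R) * A)).
  field; rewrite ?f0 ?e20//.
by rewrite b2 subrr mulr0.
Qed.

(** * Monomials as combinations of disk polynomials *)

Section Inversion.
Context {K : numFieldType} (al : nat) (al_gt0 : (0 < al)%N).
Implicit Types w v : K.

(** The dimension formula for [n = al + 1], with its factorials gathered into [disk_gamma];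
    [dim_calH] identifies it with the dimension. *)
Definition dim_weight p q : K :=
  (al + p + q)%:R / al%:R * (disk_gamma al p * disk_gamma al q).

(** The coefficients of [2F1(p + n, q + n; p + q + n; x)] for [n = al + 1], divided by
    [2F1(p, q; p + q + n; 1)]. They are the [e_k] of the overview. *)
Definition euler_coef p q k : K :=
  (p + al + k)`!%:R * (q + al + k)`!%:R
  / (al`!%:R * (p + q + al + k)`!%:R * k`!%:R).

Let f0 k : k`!%:R != 0 :> K. Proof. by rewrite pnatr_eq0 -lt0n fact_gt0. Qed.

Let al0 : al%:R != 0 :> K. Proof. by rewrite pnatr_eq0 -lt0n. Qed.

Let pochE k : pochhammer al%:R k = (al + k - 1)`!%:R / (al - 1)`!%:R :> K.
Proof.
case: al al_gt0 => // a _; rewrite addSn !subn1/= -pochhammer_fact.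
by rewrite mulfK.
Qed.

Lemma bin_factE (m i : nat) : (i <= m)%N ->
  'C(m, i)%:R = m`!%:R / (i`!%:R * (m - i)`!%:R) :> K.
Proof. by move=> im; rewrite -(bin_fact im) !natrM mulfK// mulf_neq0. Qed.

(** After expanding each [disk] and collecting by [j = k + i], the coefficient of [w^(a-j) v^(b-j)]
    is a multiple of the sum of [alt_factorial_sum] with [M = al + a + b]. Only [j = 0] survives. *)
Lemma disk_inversion w v a b :
  disk_gamma al.+1 a * disk_gamma al.+1 b * (w ^+ a * v ^+ b) =
  \sum_(k < (minn a b).+1)
     dim_weight (a - k) (b - k) * euler_coef (a - k) (b - k) k
     * disk al w v (a - k) (b - k).
Proof.
have [m mE] : {m | m = minn a b} by exists (minn a b).
have [M ME] : {M | M = al + a + b}%N by exists (al + a + b)%N.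
rewrite -mE.
pose F k j : K := (a + al)`!%:R * (b + al)`!%:R / al`!%:R
  * ((M%:R - (2 * k)%:R) / al%:R) / ((M - k)`!%:R * k`!%:R) * (-1) ^+ (j - k)
  * ((M - k - j - 1)`!%:R / (al - 1)`!%:R)
  / ((a - j)`!%:R * (b - j)`!%:R * (j - k)`!%:R) * (w ^+ (a - j) * v ^+ (b - j)).
transitivity (\sum_(k < m.+1) \sum_(i < m.+1 - k) F k (k + i)%N); last first.
  apply: eq_bigr => k _; have km := ltn_ord k.
  have -> : (m.+1 - k = (minn (a - k) (b - k)).+1)%N by lia.
  rewrite /disk /disk_sum mulr_suml mulr_sumr; apply: eq_bigr => i _.
  have ia : (i <= a - k)%N by have := ltn_ord i; lia.
  have ib : (i <= b - k)%N by have := ltn_ord i; lia.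
  rewrite /F /dim_weight /euler_coef /disk_coef /disk_gamma.
  have -> : (a - k + al + k = a + al)%N by lia.
  have -> : (b - k + al + k = b + al)%N by lia.
  have -> : (a - k + (b - k) + al + k = M - k)%N by lia.
  have -> : (al + (a - k) + (b - k))%:R = M%:R - (2 * k)%:R :> K.
    by rewrite -natrB; [congr (_%:R); lia | lia].
  rewrite !natrM !bin_factE// (pochE (_ + _ - _)%N).
  have -> : (al + (a - k + (b - k) - i) - 1 = M - k - (k + i) - 1)%N.
    by lia.
  have -> : (k + i - k = i)%N by lia.
  rewrite -!subnDA.
  have P0 j : pochhammer al%:R j != 0 :> K by rewrite gt_eqF// pochhammer_gt0 ?ltr0n.
  by field; rewrite !f0 !P0 al0.
rewrite big_triangle big_ord_recl/= big_ord1 [X in _ = _ + X]big1 ?addr0; last first.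
  move=> j _; rewrite /bump add1n; set J := j.+1.
  have Jm : (J <= m)%N by rewrite /J; have := ltn_ord j; lia.
  have JM : (2 * J < M)%N by lia.
  transitivity ((-1) ^+ J * ((a + al)`!%:R * (b + al)`!%:R / al`!%:R / al%:R /
    (al - 1)`!%:R / ((a - J)`!%:R * (b - J)`!%:R * J`!%:R) * (w ^+ (a - J) * v ^+ (b - J)))
    * \sum_(k < J.+1) (-1) ^+ k * 'C(J, k)%:R * (M%:R - (2 * k)%:R) *
    (M - k - J - 1)`!%:R / (M - k)`!%:R); last by rewrite alt_factorial_sum// mulr0.
  rewrite mulr_sumr; apply: eq_bigr => k _.
  have kJ : (k <= J)%N by rewrite -ltnS.
  rewrite /F bin_factE// -signr_odd oddB// signr_addb !signr_odd.
  by field; rewrite !f0 al0.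
rewrite /F !subn0 subr0 fact0.
have := @alt_factorial_sum K M 0; rewrite big_ord1 bin0 !subn0 subr0 !mulr1 !mul1r.
rewrite muln0/= => /(_ _)/eqP; rewrite -[X in _ == X]/1 => e.
have {}e : M%:R * (M - 1)`!%:R = M`!%:R :> K.
  by rewrite -natrM; congr (_%:R); rewrite ME; case: al al_gt0 => // x _; rewrite !addSn subn1 factS.
have {}e : M%:R = M`!%:R / (M - 1)`!%:R :> K by rewrite -e mulfK.
have e' : al%:R = al`!%:R / (al - 1)`!%:R :> K.
  by case: al al_gt0 => // x _; rewrite subn1 factS natrM mulfK.
rewrite {1}e e' /disk_gamma.
have pE c : pochhammer al.+1%:R c = (al + c)`!%:R / al`!%:R :> K.
  by rewrite -pochhammer_fact mulfK.
rewrite !pE ![(_ + al)%N]addnC.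
by field; rewrite !f0.
Qed.

End Inversion.

(* The Pfaff-Saalschuetz summation, in the polynomial form that gives Euler's
   transformation of 2F1; the summands differ by [G k j.+1 - G k j] with
   [G k j = - 'C(k, j.-1) (p)_j (q)_j (x)_(k-j+1) (c+j-1)_(k-j+1)]. *)
Lemma saalschuetz (K : comNzRingType) (x p q : K) k :
  \sum_(j < k.+1) 'C(k, j)%:R * pochhammer x (k - j) * pochhammer p j *
     pochhammer q j * pochhammer (p + q + x + j%:R) (k - j) =
  pochhammer (p + x) k * pochhammer (q + x) k.
Proof.
set c := p + q + x.
elim: k => [|k IH]; first by rewrite big_ord1 bin0 !pochhammer0 !mulr1.
pose t k j := 'C(k, j)%:R * pochhammer x (k - j) * pochhammer p j *
     pochhammer q j * pochhammer (c + j%:R) (k - j).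
pose G j := if j is i.+1 then - ('C(k, i)%:R * pochhammer p j * pochhammer q j *
  pochhammer x (k - i) * pochhammer (c + i%:R) (k - i)) else 0.
have step j : (j <= k)%N ->
    t k.+1 j = (p + x + k%:R) * (q + x + k%:R) * t k j + (G j.+1 - G j).
  move=> jk; rewrite /t subSn// pochhammerS.
  have e : (k - j)%:R = k%:R - j%:R :> K by rewrite natrB.
  have pc : pochhammer (c + j%:R) (k - j).+1 =
      pochhammer (c + j%:R) (k - j) * (c + k%:R) by rewrite pochhammerS e; ring.
  rewrite pc e; case: j jk e {pc} => [|j] jk e.
    rewrite /G !bin0 !pochhammerS !pochhammer0 subn0 /c !addr0; ring.
  rewrite /G.
  have -> : (k - j = (k - j.+1).+1)%N by lia.
  rewrite (pochhammerS x) [pochhammer (c + j%:R) _]pochhammer_recl.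
  rewrite e (pochhammerS p j.+1) (pochhammerS q j.+1).
  rewrite -[c + j%:R + 1]addrA natr1 binS natrD.
  have b : j.+1%:R * 'C(k, j.+1)%:R = (k%:R - j%:R) * 'C(k, j)%:R :> K.
    by rewrite -natrB 1?ltnW// -!natrM mul_bin_left.
  rewrite -[j.+1%:R]natr1 in b *.
  set P := pochhammer x _; set Q := pochhammer (c + _) _; set A := pochhammer p _.
  set B := pochhammer q _.
  set U := 'C(k, j.+1)%:R in b *; set V := 'C(k, j)%:R in b *.
  apply/eqP; rewrite -subr_eq0; apply/eqP.
  transitivity (P * Q * A * B * (x + (k%:R - (j%:R + 1))) * ((k%:R - j%:R) * V - (j%:R + 1) * U)).
    by rewrite /c; ring.
  by rewrite b subrr mulr0.
rewrite !pochhammerS mulrACA -IH big_ord_recr/=.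
rewrite (eq_bigr (fun j : 'I_k.+1 => (p + x + k%:R) * (q + x + k%:R) * t k j
  + (G j.+1 - G j))); last by move=> j _; rewrite -step// -ltnS.
rewrite big_split -mulr_sumr -addrA -[RHS]addr0; congr (_ + _); first exact: mulrC.
rewrite -(big_mkord predT (fun j => G j.+1 - G j)) telescope_sumr//.
rewrite /G subr0 subnn !binn !pochhammer0 subnn !pochhammer0; ring.
Qed.

(** A finite form of the contiguous relation [(c - a - b - 1) F(a + 1) = (c - a - 1) F(a)] between
    values of [2F1] at [1]. Once the boundary term tends to [0], it raises [a] by one. *)
Lemma gauss_telescope (K : fieldType) (a b c : K) N :
  (forall k, pochhammer c k != 0) -> (forall k, k`!%:R != 0 :> K) ->
  (c - a - b - 1) * (\sum_(k < N.+1) pochhammer (a + 1) k * pochhammer b k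
     / pochhammer c k / k`!%:R) =
  (c - a - 1) * (\sum_(k < N.+1) pochhammer a k * pochhammer b k
     / pochhammer c k / k`!%:R)
  - pochhammer (a + 1) N * pochhammer b N.+1 / (pochhammer c N * N`!%:R).
Proof.
move=> c0 f0; elim: N => [|N IH].
  by rewrite !big_ord1 pochhammerS !pochhammer0 fact0 addr0 !(mulr1, mul1r, invr1); ring.
rewrite big_ord_recr/= mulrDr IH [in RHS]big_ord_recr/=.
have := c0 N.+1; rewrite pochhammerS mulf_eq0 negb_or => /andP[_ cN].
have N0 : N.+1%:R != 0 :> K.
  by apply: contra (f0 N.+1); rewrite factS natrM => /eqP ->; rewrite mul0r.
rewrite (pochhammer_recl a) (pochhammerS (a + 1)) (pochhammerS b N.+1).
rewrite ?(pochhammerS c) factS natrM.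
have := f0 N; have := c0 N => ? ?.
rewrite -[N.+1%:R]natr1 in N0 *.
by field; do ?(apply/andP; split).
Qed.

(** The form in which linear algebra delivers the dimension: ['C(p + al, al)] counts the monomials
    of degree [p] in [al + 1] variables. With both products written through [disk_gamma], it amounts
    to [(al + p) (al + q) - p q = al (al + p + q)]. *)
Lemma dim_weight_bin (K : numFieldType) al p q : (0 < al)%N ->
  dim_weight al p q =
  ('C(p + al, al) * 'C(q + al, al))%:R
  - (if (p == 0)%N || (q == 0)%N then 0 else ('C(p.-1 + al, al) * 'C(q.-1 + al, al)))%:R
  :> K.
Proof.
move=> al0.
have f0 k : k`!%:R != 0 :> K by rewrite pnatr_eq0 -lt0n fact_gt0.
have a0 : al%:R != 0 :> K by rewrite pnatr_eq0 -lt0n.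
have E k : 'C(k + al, al)%:R = disk_gamma al k * (al%:R + k%:R) / al%:R :> K.
  rewrite bin_factE ?leq_addl// addnK /disk_gamma.
  have <- : pochhammer al.+1%:R k * al`!%:R = (k + al)`!%:R :> K.
    by rewrite addnC pochhammer_fact.
  have -> : pochhammer al.+1%:R k = pochhammer al%:R k * (al%:R + k%:R) / al%:R :> K.
    by rewrite -pochhammerS pochhammer_recl natr1 mulrC mulKf.
  by field; rewrite !f0 a0.
have E' k : 'C(k + al, al)%:R = disk_gamma al k.+1 * k.+1%:R / al%:R :> K.
  rewrite E /disk_gamma pochhammerS factS natrM; field.
  by rewrite !f0 a0 nat1r pnatr_eq0.
rewrite /dim_weight !natrM 2!E.
case: p => [|p]; first by rewrite /= !addr0 addn0 natrD subr0; field.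
case: q => [|q]; first by rewrite orbT/= !addr0 addn0 natrD subr0; field.
by rewrite /= natrM 2!E' !natrD; field.
Qed.

(** * Dimension of the spaces of harmonic polynomials *)

Section Dimension.
Context {K : fieldType} {E : lmodType K}.

Lemma is_basis_le (V : set E) d d' (b : 'I_d -> E) (b' : 'I_d' -> E) :
  is_basis V b -> is_basis V b' -> (d <= d')%N.
Proof.
move=> [Vb fb sb] [Vb' _ sb'].
have /choice[M ME] : forall i, exists c : 'I_d' -> K, b i = \sum_j c j *: b' j.
  by move=> i; apply: sb'.
have /choice[N NE] : forall j, exists c : 'I_d -> K, b' j = \sum_i c i *: b i.
  by move=> j; apply: sb.
apply: (@mulmx1_min _ _ _ (\matrix_(i, j) M i j) (\matrix_(j, i) N j i)).
apply/matrixP => i k; apply/eqP; rewrite -subr_eq0 [1%:M _ _]mxE; apply/eqP; move: k.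
apply: (fb (fun k => _ i k - (i == k)%:R)).
under eq_bigr do rewrite scalerBl; rewrite sumrB.
have -> : \sum_k (i == k)%:R *: b k = b i.
  rewrite (bigD1 i)//= big1 ?addr0 ?eqxx ?scale1r// => k ki.
  by rewrite eq_sym (negbTE ki) scale0r.
rewrite [in X in _ - X]ME; apply/eqP; rewrite subr_eq0; apply/eqP.
under eq_bigr do rewrite mxE scaler_suml.
rewrite exchange_big/=; apply: eq_bigr => j _; rewrite NE scaler_sumr.
by apply: eq_bigr => k _; rewrite !mxE scalerA.
Qed.

Lemma subspace_dimE (V : set E) d (b : 'I_d -> E) :
  is_basis V b -> subspace_dim V = d.
Proof.
move=> Vb; apply: xget_unique; first by exists b.
move=> d' [b' Vb'] /=; apply/eqP; rewrite eqn_leq.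
by rewrite (is_basis_le Vb Vb') (is_basis_le Vb' Vb).
Qed.

(** In the coordinates [e] the space is the left kernel of [A], so a basis is read off from
    [row_base (kermx A)]. *)
Lemma subspace_dim_ker (V : set E) N N' (e : 'I_N -> E) (A : 'M[K]_(N, N')) :
  (forall c : 'rV[K]_N, \sum_i c 0 i *: e i = 0 -> c = 0) ->
  (forall v, V v <-> exists2 c : 'rV[K]_N, v = \sum_i c 0 i *: e i & c *m A = 0) ->
  subspace_dim V = (N - \rank A)%N.
Proof.
move=> free_e VE; rewrite -mxrank_ker.
pose B := row_base (kermx A).
have sumB (c : 'rV_(\rank (kermx A))) :
    \sum_i (c *m B) 0 i *: e i = \sum_k c 0 k *: \sum_i B k i *: e i.
  under [RHS]eq_bigr do rewrite scaler_sumr.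
  rewrite exchange_big/=; apply: eq_bigr => i _; rewrite mxE scaler_suml.
  by apply: eq_bigr => k _; rewrite scalerA.
apply: (@subspace_dimE V _ (fun k => \sum_i B k i *: e i)); split.
- move=> k; apply/VE; exists (row k B).
    by apply: eq_bigr => i _; rewrite [row k B 0 i]mxE.
  apply/eqP; rewrite -sub_kermx; apply: submx_trans (row_sub _ _) _.
  by rewrite eq_row_base.
- move=> c c0 k.
  have : (\row_k c k) *m B = 0.
    by apply: free_e; rewrite sumB -[RHS]c0; apply: eq_bigr => j _; rewrite mxE.
  have : row_free B by exact: row_base_free.
  rewrite -kermx_eq0 => /eqP kB /eqP; rewrite -sub_kermx kB submx0 => /eqP/rowP/(_ k).
  by rewrite !mxE.
- move=> v /VE[c -> cA].
  have : (c <= B)%MS by rewrite eq_row_base sub_kermx cA.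
  by case/submxP => D ->; exists (D 0); rewrite sumB.
Qed.

End Dimension.

(** * Polynomials in [z] and its conjugate are determined by their values *)

Section EvaluationInjective.
Context {R : realType} {n : nat}.
Local Notation C := R[i].

Definition conj_point (z : 'rV[C]_n) (k : 'I_(n + n)) : C :=
  match fintype.split k with inl j => z 0 j | inr j => (z 0 j)^* end.

Lemma pevalE (P : mpoly (n + n) C) z : peval P z = meval (conj_point z) P.
Proof. by []. Qed.

Lemma conj_point_l z j : conj_point z (lshift n j) = z 0 j.
Proof. by rewrite /conj_point; case: split_ordP => k /eqP; rewrite ?eq_lshift ?eq_lrshift// => /eqP ->. Qed.

Lemma conj_point_r z j : conj_point z (rshift n j) = (z 0 j)^*.
Proof. by rewrite /conj_point; case: split_ordP => k /eqP; rewrite ?eq_rshift ?eq_rlshift// => /eqP ->. Qed.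

(** The restriction to a line is a polynomial in [t] whose derivative at [0] is the directional
    derivative. The property holds for constants and variables and is stable under sums and
    products. *)
Lemma meval_line k (v u : 'I_k -> C) (P : mpoly k C) :
  exists2 f : {poly C}, forall t, f.[t] = meval (fun i => v i + t * u i) P
    & f^`().[0] = \sum_i u i * meval v (mderiv i P).
Proof.
pose Q P := exists2 f : {poly C}, forall t, f.[t] = meval (fun i => v i + t * u i) P
    & f^`().[0] = \sum_i u i * meval v (mderiv i P).
have v0 P' : meval (fun i => v i + 0 * u i) P' = meval v P'.
  by apply: meval_eq => i; rewrite mul0r addr0.
have QC c : Q (mpolyC k c).
  exists c%:P => [t|]; first by rewrite mevalC hornerC.
  by rewrite derivC horner0 big1// => i _; rewrite mderivC meval0 mulr0.
have QX i : Q (mpolyX C (mnm1 i)).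
  exists ((v i)%:P + (u i) *: 'X) => [t|]; first by rewrite mevalXU !hornerE; ring.
  rewrite derivD derivC derivZ derivX add0r hornerZ hornerC mulr1 (bigD1 i)//= big1 ?addr0 => [|j ji].
    rewrite mderivX mevalZ mnm1E eqxx mul1r.
    by rewrite (_ : mnm_sub _ _ = mnm0) ?mpolyX0 ?meval1 ?mulr1//; apply/mnmP => l; rewrite mnmBE subnn mnm0E.
  by rewrite mderivX mnm1E eq_sym (negbTE ji) scale0r meval0 mulr0.
have QD P1 P2 : Q P1 -> Q P2 -> Q (P1 + P2).
  move=> [f1 e1 d1] [f2 e2 d2]; exists (f1 + f2) => [t|].
    by rewrite hornerD e1 e2 mevalD.
  rewrite derivD hornerD d1 d2 -big_split/=; apply: eq_bigr => i _.
  by rewrite mderivD mevalD mulrDr.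
have QM P1 P2 : Q P1 -> Q P2 -> Q (P1 * P2).
  move=> [f1 e1 d1] [f2 e2 d2]; exists (f1 * f2) => [t|].
    by rewrite hornerM e1 e2 mevalM.
  rewrite derivM hornerD !hornerM d1 d2 e1 e2 !v0 mulr_suml mulr_sumr -big_split/=.
  apply: eq_bigr => i _.
  rewrite mderivM mevalD !mevalM mulrDr.
  by congr (_ + _); [exact/esym/mulrA|exact: mulrCA].
rewrite -/(Q P); clearbody Q.
elim/mpolyind: P => [|c m P _ _ IH]; first by rewrite -(mpolyC0 k C); apply: QC.
apply: (QD) IH; rewrite -mul_mpolyC; apply: (QM); first exact: QC.
have Q1 : Q 1 by rewrite -mpolyC1; apply: QC.
rewrite mpolyXE_id; apply: (big_ind Q); [exact: Q1|exact: (QM)|].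
move=> i _; elim: (m i) => [|j IHj]; first by rewrite expr0.
by rewrite exprS; apply: QM.
Qed.

(** The points [conj_point z] form only a real subspace, and [z + t d] traces a line in it for real
    [t]. Natural values of [t] already give enough roots to kill the restriction to this line. The
    directions [e_j] and [i e_j] then separate the derivative in [z_j] from the one in its
    conjugate. *)
Lemma peval_eq0_mderiv (P : mpoly (n + n) C) k :
  (forall z, peval P z = 0) -> forall z, peval (mderiv k P) z = 0.
Proof.
move=> P0 z.
have dir d : \sum_i conj_point d i * peval (mderiv i P) z = 0.
  have [f fE <-] := meval_line (conj_point z) (conj_point d) P.
  suff -> : f = 0 by rewrite deriv0 horner0.
  apply: (@roots_geq_poly_eq0 _ _ [seq i%:R : C | i <- iota 0 (size f)]).
  - apply/allP => _ /mapP[i _ ->]; rewrite rootE fE.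
    rewrite -[X in _ == X](P0 (z + i%:R *: d)) pevalE; apply/eqP; apply: meval_eq => l.
    rewrite /conj_point; case: fintype.split => j; rewrite !mxE//.
    by rewrite rmorphD rmorphM rmorph_nat.
  - by rewrite map_inj_uniq ?iota_uniq// => i j /eqP; rewrite eqr_nat => /eqP.
  - by rewrite size_map size_iota.
have dirj (c : C) j : c * peval (mderiv (lshift n j) P) z
    + c^* * peval (mderiv (rshift n j) P) z = 0.
  rewrite -[RHS](dir (c *: delta_mx 0 j)) big_split_ord/=; congr (_ + _).
    rewrite (bigD1 j)//= conj_point_l !mxE !eqxx mulr1 big1 ?addr0// => i ij.
    by rewrite conj_point_l !mxE (negbTE ij) andbF mulr0 mul0r.
  rewrite (bigD1 j)//= conj_point_r !mxE !eqxx mulr1 big1 ?addr0// => i ij.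
  by rewrite conj_point_r !mxE (negbTE ij) andbF mulr0 rmorph0 mul0r.
pose I : C := 'i%C.
have cI : Num.conj I = - I by apply/eqP; rewrite eq_complex /= oppr0 !eqxx.
have i0 : I != 0 by rewrite eq_complex /= oner_eq0 andbF.
have two0 : 2 != 0 :> C by rewrite pnatr_eq0.
have both j : peval (mderiv (lshift n j) P) z = 0 /\ peval (mderiv (rshift n j) P) z = 0.
  have := dirj 1 j; have := dirj I j; rewrite cI rmorph1 !mul1r.
  rewrite mulNr -mulrBr => /eqP; rewrite mulf_eq0 (negbTE i0) subr_eq0 /= => /eqP ->.
  by rewrite -mulr2n -mulr_natl => /eqP; rewrite mulf_eq0 (negbTE two0) => /eqP.
by case: (split_ordP k) => j ->; have [] := both j.
Qed.

(** Iterated derivatives also vanish at these points; at [z = 0] the derivative of multi-order [m]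
    is the coefficient of [m] times a nonzero product of factorials. *)
Lemma peval_inj0 (P : mpoly (n + n) C) : (forall z, peval P z = 0) -> P = 0.
Proof.
move=> P0; apply/mpolyP => m; rewrite mcoeff0.
have : forall z, peval (mderivm m P) z = 0.
  rewrite mderivm_foldr; elim: (flatten _) => [|k s IH]//=.
  exact: peval_eq0_mderiv.
move=> /(_ 0); rewrite pevalE => P0'.
have : mcoeff mnm0 (mderivm m P) = 0.
  rewrite -[RHS]P0' mevalE; have [h|h] := boolP (mnm0 \in msupp (mderivm m P)).
    rewrite (bigD1_seq mnm0)//= [X in _ * X]big1 ?mulr1; last first.
      by move=> i _; rewrite mnm0E.
    rewrite big1 ?addr0// => m' m'0; have [i mi] : exists i, m' i != 0%N.
      apply/existsP; apply: contraR m'0 => /existsPn h'; apply/eqP/mnmP => i.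
      by rewrite mnm0E; apply/eqP; have := h' i; rewrite negbK.
    rewrite (bigD1 i)//= /conj_point; case: fintype.split => j;
      by rewrite mxE ?rmorph0 expr0n (negbTE mi) mul0r mulr0.
  rewrite (memN_msupp_eq0 h) big_seq big1// => m' m's.
  have [i mi] : exists i, m' i != 0%N.
    apply/existsP; apply: contraNT h => /existsPn h'.
    rewrite (_ : mnm0 = m')//; apply/mnmP => i.
    by rewrite mnm0E; apply/esym/eqP; have := h' i; rewrite negbK.
  by rewrite (bigD1 i)//= /conj_point; case: fintype.split => j;
    rewrite mxE ?rmorph0 expr0n (negbTE mi) mul0r mulr0.
rewrite mcoeff_mderivm addm0 -mulr_natr => /eqP; rewrite mulf_eq0 => /orP[/eqP//|].
rewrite pnatr_eq0 => /eqP e; exfalso.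
have : (0 < \prod_(i < n + n) m i ^_ m i)%N.
  by rewrite prodn_gt0// => i; rewrite ffactnn fact_gt0.
by rewrite e.
Qed.

End EvaluationInjective.

(** * Bidegree of monomials *)

Section Bidegree.
Context {R : realType} {n : nat}.
Local Notation C := R[i].
Local Notation mono := (multinom (n + n)).

Definition ldeg (m : mono) : nat := (\sum_(j < n) m (lshift n j))%N.
Definition rdeg (m : mono) : nat := (\sum_(j < n) m (rshift n j))%N.

Lemma ldegD m1 m2 : ldeg (mnm_add m1 m2) = (ldeg m1 + ldeg m2)%N.
Proof. by rewrite /ldeg -big_split/=; apply: eq_bigr => j _; rewrite mnmDE. Qed.

Lemma rdegD m1 m2 : rdeg (mnm_add m1 m2) = (rdeg m1 + rdeg m2)%N.
Proof. by rewrite /rdeg -big_split/=; apply: eq_bigr => j _; rewrite mnmDE. Qed.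

Lemma ldeg_l j : ldeg (mnm1 (lshift n j)) = 1%N.
Proof.
rewrite /ldeg (bigD1 j)//= mnm1E eqxx big1// => i ij.
by rewrite mnm1E eq_lshift eq_sym (negbTE ij).
Qed.

Lemma rdeg_l j : rdeg (mnm1 (lshift n j)) = 0%N.
Proof. by rewrite /rdeg big1// => i _; rewrite mnm1E eq_lrshift. Qed.

Lemma ldeg_r j : ldeg (mnm1 (rshift n j)) = 0%N.
Proof. by rewrite /ldeg big1// => i _; rewrite mnm1E eq_rlshift. Qed.

Lemma rdeg_r j : rdeg (mnm1 (rshift n j)) = 1%N.
Proof.
rewrite /rdeg (bigD1 j)//= mnm1E eqxx big1// => i ij.
by rewrite mnm1E eq_rshift eq_sym (negbTE ij).
Qed.

Definition bidegree_supp p q (P : mpoly (n + n) C) : Prop :=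
  forall m, mcoeff m P != 0 -> (ldeg m, rdeg m) = (p, q).

Lemma meval_conj_point_mono (z : 'rV[C]_n) (lam : C) (m : mono) :
  \prod_i conj_point (lam *: z) i ^+ m i =
  lam ^+ ldeg m * lam^* ^+ rdeg m * \prod_i conj_point z i ^+ m i.
Proof.
rewrite !big_split_ord/= mulrACA; congr (_ * _).
  rewrite /ldeg -prodrXr -big_split/=; apply: eq_bigr => j _.
  by rewrite !conj_point_l !mxE exprMn.
rewrite /rdeg -prodrXr -big_split/=; apply: eq_bigr => j _.
by rewrite !conj_point_r !mxE rmorphM exprMn.
Qed.

End Bidegree.

(** Both sides are values of monomials in the two variables attached to [C^1], so [peval_inj0] with
    one complex variable makes the monomials equal. *)
Lemma conj_monomial_inj (R : realType) (p q l k : nat) :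
  (forall lam : R[i], lam ^+ l * lam^* ^+ k = lam ^+ p * lam^* ^+ q) ->
  (l, k) = (p, q).
Proof.
move=> h; pose mn a b : multinom (1 + 1) := Multinom [tuple if (i == 0 :> nat) then a else b | i < 1 + 1].
have mn0 a b : mn a b (lshift 1 ord0) = a by rewrite mnmE.
have mn1 a b : mn a b (rshift 1 ord0) = b by rewrite mnmE.
have : mpolyX R[i] (mn l k) - mpolyX R[i] (mn p q) = 0.
  apply: peval_inj0 => z; rewrite pevalE mevalB !mevalX !big_split_ord/= !big_ord1.
  by rewrite !conj_point_l !conj_point_r !mn0 !mn1 h subrr.
move=> /eqP; rewrite subr_eq0 => /eqP/(congr1 (mcoeff (mn p q))).
rewrite !mcoeffX eqxx; case: eqP => [e _|_ /eqP]; last by rewrite eq_sym oner_eq0.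
by rewrite -(mn0 l k) -[in X in (_, X)](mn1 l k) e mn0 mn1.
Qed.

Section Laplacian.
Context {R : realType} {n : nat}.
Local Notation C := R[i].
Local Notation mono := (multinom (n + n)).
Implicit Types P Q : mpoly (n + n) C.

Lemma bihomogeneousP p q P : bihomogeneous p q P <-> bidegree_supp p q P.
Proof.
split=> [hom m Pm|supp lam z].
  apply: (@conj_monomial_inj R) => lam.
  (* [Q] is [P] composed with scaling by [lam]. Bihomogeneity equates values only; [peval_inj0]
     turns this into an equality of coefficients. *)
  pose Q : mpoly (n + n) C := \sum_(m <- msupp P)
    (mcoeff m P * (lam ^+ ldeg m * lam^* ^+ rdeg m)) *: mpolyX C m.
  have /(congr1 (mcoeff m)) : Q - (lam ^+ p * lam^* ^+ q) *: P = 0.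
    apply: peval_inj0 => z; rewrite pevalE mevalB mevalZ raddf_sum/= -[meval _ P]pevalE -hom.
    rewrite pevalE mevalE -sumrB big1_seq// => m' _.
    by rewrite mevalZ mevalX meval_conj_point_mono; ring.
  rewrite mcoeff0 mcoeffB mcoeffZ raddf_sum/= (bigD1_seq m)//= ?mcoeff_msupp//.
  rewrite big1 ?addr0 => [|m' m'm]; last first.
    by rewrite mcoeffZ mcoeffX (negbTE m'm) mulr0.
  rewrite mcoeffZ mcoeffX eqxx mulr1 mulrC -mulrBl => /eqP.
  by rewrite mulf_eq0 (negbTE Pm) orbF subr_eq0 => /eqP.
rewrite !pevalE !mevalE mulr_sumr; apply: eq_big_seq => m.
rewrite mcoeff_msupp => /supp[<- <-].
by rewrite meval_conj_point_mono; ring.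
Qed.

Definition laplacian0 P : mpoly (n + n) C :=
  \sum_(j < n) mderiv (lshift n j) (mderiv (rshift n j) P).

Lemma laplacian0D P Q : laplacian0 (P + Q) = laplacian0 P + laplacian0 Q.
Proof. by rewrite /laplacian0 -big_split/=; apply: eq_bigr => j _; rewrite !mderivD. Qed.

Lemma laplacian0Z c P : laplacian0 (c *: P) = c *: laplacian0 P.
Proof. by rewrite /laplacian0 scaler_sumr; apply: eq_bigr => j _; rewrite !mderivZ. Qed.

Lemma laplacian0_0 : laplacian0 0 = 0.
Proof. by have := laplacian0Z 0 0; rewrite !scale0r. Qed.

Lemma laplacian0_sum I (s : seq I) (a : pred I) (F : I -> mpoly (n + n) C) :
  laplacian0 (\sum_(i <- s | a i) F i) = \sum_(i <- s | a i) laplacian0 (F i).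
Proof. exact: (big_morph laplacian0 laplacian0D laplacian0_0). Qed.

Lemma laplacian_eq0 P : laplacian P = 0 <-> laplacian0 P = 0.
Proof.
rewrite /laplacian -/(laplacian0 P); split=> [/eqP|->]; last by rewrite scaler0.
by rewrite scaler_eq0 pnatr_eq0 => /eqP.
Qed.

Lemma laplacian0X (m : mono) : laplacian0 (mpolyX C m) =
  \sum_(j < n) (m (lshift n j) * m (rshift n j))%:R *:
    mpolyX C (mnm_sub (mnm_sub m (mnm1 (rshift n j))) (mnm1 (lshift n j))).
Proof.
apply: eq_bigr => j _; rewrite mderivX mderivZ mderivX scalerA mnmBE mnm1E.
by rewrite eq_rlshift subn0 -natrM mulnC.
Qed.

Lemma bidegree_supp_laplacian0 p q P m : bidegree_supp p q P ->
  mcoeff m (laplacian0 P) != 0 -> ((ldeg m).+1, (rdeg m).+1) = (p, q).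
Proof.
move=> supp; rewrite raddf_sum/= => h.
have [j hj] : exists j, mcoeff m (mderiv (lshift n j) (mderiv (rshift n j) P)) != 0.
  apply/existsP; apply: contraNT h => /existsPn h; apply/eqP; apply: big1 => j _.
  by apply/eqP; have := h j; rewrite negbK.
move: hj; rewrite !mcoeff_mderiv.
set m' := mnm_add _ _ => hj.
have /supp : mcoeff m' P != 0.
  by apply: contra hj => /eqP ->; rewrite !mul0rn.
by rewrite /m' !ldegD !rdegD ldeg_l rdeg_l ldeg_r rdeg_r !addn0 !addn1.
Qed.

(* The degree of [m] in the variables z_j, j <> j0, decreases in the error
   term of the approximate preimage [X_m z_(j0) zbar_(j0)]. *)
Lemma laplacian0_surj (j0 : 'I_n) (m : mono) :
  exists2 P, bidegree_supp (ldeg m).+1 (rdeg m).+1 P & laplacian0 P = mpolyX C m.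
Proof.
have [s] := ubnP (\sum_(j < n | j != j0) m (lshift n j))%N.
elim: s m => // s IH m /ltnSE ms.
pose l := (ldeg m).+1; pose k := (rdeg m).+1.
pose im F := exists2 P, bidegree_supp l k P & laplacian0 P = F.
have im0 : im 0 by exists 0; rewrite ?laplacian0_0// => m'; rewrite mcoeff0 eqxx.
have imD F G : im F -> im G -> im (F + G).
  move=> [P sP <-] [Q sQ <-]; exists (P + Q); last by rewrite laplacian0D.
  move=> m'; rewrite mcoeffD; have [->|P0 _] := eqVneq (mcoeff m' P) 0; last exact: sP.
  by rewrite add0r; exact: sQ.
have imZ c F : im F -> im (c *: F).
  move=> [P sP <-]; exists (c *: P); last by rewrite laplacian0Z.
  by move=> m'; rewrite mcoeffZ mulf_eq0 negb_or => /andP[_ /sP].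
pose M := mnm_add (mnm_add m (mnm1 (rshift n j0))) (mnm1 (lshift n j0)).
have imM : im (laplacian0 (mpolyX C M)).
  exists (mpolyX C M) => // m'; rewrite mcoeffX.
  have [<- _|_] := eqVneq M m'; last by rewrite eqxx.
  by rewrite /M !ldegD !rdegD ldeg_l rdeg_l ldeg_r rdeg_r !addn0 !addn1.
rewrite -/(im _).
have MM : mnm_sub (mnm_sub M (mnm1 (rshift n j0))) (mnm1 (lshift n j0)) = m.
  by apply/mnmP => i; rewrite !mnmBE !mnmDE; lia.
have := laplacian0X M; rewrite (bigD1 j0)//= MM.
set c := (_ * _)%:R => e.
have c0 : c != 0.
  by rewrite /c pnatr_eq0 -lt0n muln_gt0 /M !mnmDE !mnm1E !eqxx !addn1 eq_lrshift addn0.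
have -> : mpolyX C m = c^-1 *: (laplacian0 (mpolyX C M) - (laplacian0 (mpolyX C M) - c *: mpolyX C m)).
  by rewrite opprB addrC subrK scalerA mulVf// scale1r.
apply: (imZ); apply: (imD) => //; rewrite -scaleN1r; apply: (imZ).
rewrite e [X in X - _]addrC addrK; apply: (big_ind im) => // j jj0.
set m' := mnm_sub _ _.
have [->|mj0] := eqVneq (M (lshift n j) * M (rshift n j))%N 0%N.
  by rewrite mulr0n scale0r.
have [mlj mrj] : (0 < m (lshift n j))%N /\ (0 < m (rshift n j))%N.
  move: mj0; rewrite -lt0n muln_gt0 /M !mnmDE !mnm1E !eq_lrshift !eq_rlshift eq_lshift eq_rshift.
  by rewrite eq_sym (negbTE jj0) !addn0 => /andP[].
apply: (imZ).
(* [m'] is [m] with one unit moved from index [j] to [j0] in both halves. The equation is kept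
   additive because natural subtraction truncates. *)
have m'l i : (m' (lshift n i) + (i == j) = m (lshift n i) + (i == j0))%N.
  rewrite /m' /M !mnmBE !mnmDE !mnm1E eq_rlshift !eq_lshift ![_ == i]eq_sym eq_rlshift.
  by have [->|] := eqVneq i j; rewrite /= ?subn0; lia.
have m'r i : (m' (rshift n i) + (i == j) = m (rshift n i) + (i == j0))%N.
  rewrite /m' /M !mnmBE !mnmDE !mnm1E eq_lrshift !eq_rshift ![_ == i]eq_sym eq_lrshift.
  by have [->|] := eqVneq i j; rewrite /= ?subn0; lia.
have sum1 i0 : (\sum_(i < n) (i == i0 :> 'I_n) = 1)%N.
  by rewrite (bigD1 i0)//= eqxx big1// => i /negbTE ->.
have lm' : ldeg m' = ldeg m.
  apply/eqP; rewrite -(eqn_add2r 1) -{1}(sum1 j) -(sum1 j0) /ldeg -!big_split/=.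
  by apply/eqP; apply: eq_bigr => i _.
have rm' : rdeg m' = rdeg m.
  apply/eqP; rewrite -(eqn_add2r 1) -{1}(sum1 j) -(sum1 j0) /rdeg -!big_split/=.
  by apply/eqP; apply: eq_bigr => i _.
have : (\sum_(i < n | i != j0) m' (lshift n i) < s)%N.
  apply: leq_trans ms; rewrite (bigD1 j)//= [X in (_ < X)%N](bigD1 j)//=.
  rewrite -addSn leq_add//.
    by have := m'l j; rewrite eqxx (negbTE jj0) addn0 addn1 => ->.
  apply: leq_sum => i /andP[ij0 ij]; have := m'l i.
  by rewrite (negbTE ij) (negbTE ij0) !addn0 => ->.
by move=> /IH[P]; rewrite lm' rm' => sP eP; exists P.
Qed.

End Laplacian.

(** A monomial is a pair of tuples with sums [p] and [q], counted by [card_ord_partitions]. Indexing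
    by an ordinal of the exact cardinality lets the monomials label rows and columns of matrices. *)
Lemma bidegree_enum (al p q : nat) :
  exists2 mn : 'I_('C(p + al, al) * 'C(q + al, al)) -> multinom (al.+1 + al.+1),
    injective mn & forall m, (ldeg m, rdeg m) = (p, q) <-> exists i, mn i = m.
Proof.
pose A d := [set t : al.+1.-tuple 'I_d.+1 | (\sum_(i <- t) i == d)%N]%SET.
pose B := finset.setX (A p) (A q).
have cB : #|B| = ('C(p + al, al) * 'C(q + al, al))%N.
  by rewrite cardsX !card_ord_partitions ![(al + _)%N]addnC.
rewrite -cB.
pose f (x : al.+1.-tuple 'I_p.+1 * al.+1.-tuple 'I_q.+1) : multinom (al.+1 + al.+1) :=
  Multinom [tuple match fintype.split k with
    inl j => nat_of_ord (tnth x.1 j) | inr j => nat_of_ord (tnth x.2 j) end | k < al.+1 + al.+1].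
have fl x j : f x (lshift al.+1 j) = tnth x.1 j.
  by rewrite /f mnmE; case: split_ordP => k /eqP; rewrite ?eq_lshift ?eq_lrshift// => /eqP ->.
have fr x j : f x (rshift al.+1 j) = tnth x.2 j.
  by rewrite /f mnmE; case: split_ordP => k /eqP; rewrite ?eq_rshift ?eq_rlshift// => /eqP ->.
exists (fun i => f (enum_val i)) => [i1 i2 e|m].
  apply: enum_val_inj; move: (enum_val i1) (enum_val i2) e => [t1 u1] [t2 u2] /mnmP e.
  congr pair; apply: eq_from_tnth => j; apply: val_inj.
    by have := e (lshift al.+1 j); rewrite !fl.
  by have := e (rshift al.+1 j); rewrite !fr.
split=> [[lm rm]|[i <-]].
  pose x := ([tuple inord (m (lshift al.+1 j)) | j < al.+1] : al.+1.-tuple 'I_p.+1,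
             [tuple inord (m (rshift al.+1 j)) | j < al.+1] : al.+1.-tuple 'I_q.+1).
  have x1 j : tnth x.1 j = m (lshift al.+1 j) :> nat.
    by rewrite tnth_mktuple inordK// ltnS -lm /ldeg (bigD1 j)//= leq_addr.
  have x2 j : tnth x.2 j = m (rshift al.+1 j) :> nat.
    by rewrite tnth_mktuple inordK// ltnS -rm /rdeg (bigD1 j)//= leq_addr.
  have xB : x \in B.
    rewrite inE !inE !big_tuple; apply/andP; split; apply/eqP.
      by rewrite -[RHS]lm; apply: eq_bigr => j _; rewrite x1.
    by rewrite -[RHS]rm; apply: eq_bigr => j _; rewrite x2.
  exists (enum_rank_in xB x); rewrite enum_rankK_in//; apply/mnmP => k.
  by case: (split_ordP k) => j ->; rewrite ?fl ?fr ?x1 ?x2.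
have := enum_valP i; rewrite inE !inE !big_tuple => /andP[/eqP e1 /eqP e2].
by congr pair; [rewrite -[RHS]e1|rewrite -[RHS]e2]; apply: eq_bigr => j _; rewrite ?fl ?fr.
Qed.

Lemma dim_calH (R : realType) (al p q : nat) : (0 < al)%N ->
  (subspace_dim (@calH R al.+1 p q))%:R = dim_weight al p q :> R[i].
Proof.
move=> al0; pose C := R[i].
pose N := ('C(p + al, al) * 'C(q + al, al))%N.
pose N' := (if (p == 0%N) || (q == 0%N) then 0 else 'C(p.-1 + al, al) * 'C(q.-1 + al, al))%N.
have [mn mnI mnP] := bidegree_enum al p q.
(* The monomials of the target of the Laplacian. Writing their degrees with successors covers
   [p = 0] and [q = 0], where there are none and [N' = 0]. *)
have [mn' mnI' mnP'] : exists2 mn' : 'I_N' -> multinom (al.+1 + al.+1),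
    injective mn' & forall m, ((ldeg m).+1, (rdeg m).+1) = (p, q) <-> exists i, mn' i = m.
  rewrite /N'; case: p {mn mnI mnP N N'} => [|p].
    by exists (fun=> mnm0) => [[]//|m]; split => [//|[[]//]].
  case: q => [|q]; first by exists (fun=> mnm0) => [[]//|m]; split => [//|[[]//]].
  have [mn' i' P'] := bidegree_enum al p q; exists mn' => // m; rewrite -P'.
  by split=> [[-> ->]|[-> ->]].
pose A : 'M[C]_(N, N') := \matrix_(i, j) mcoeff (mn' j) (laplacian0 (mpolyX C (mn i))).
pose e (i : 'I_N) : mpoly (al.+1 + al.+1) C := mpolyX C (mn i).
have coefe (c : 'rV[C]_N) i : mcoeff (mn i) (\sum_i c 0 i *: e i) = c 0 i.
  rewrite raddf_sum/= (bigD1 i)//= mcoeffZ mcoeffX eqxx mulr1 big1 ?addr0// => j ji.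
  by rewrite mcoeffZ mcoeffX (inj_eq mnI) (negbTE ji) mulr0.
have suppe (c : 'rV[C]_N) : bidegree_supp p q (\sum_i c 0 i *: e i).
  move=> m; rewrite raddf_sum/= => h; apply/mnP.
  suff /existsP[i /eqP] : [exists i, mn i == m] by exists i.
  apply: contraNT h => /existsPn h; apply/eqP/big1 => i _.
  by rewrite mcoeffZ mcoeffX (negbTE (h i)) mulr0.
have expand P : bidegree_supp p q P ->
    P = \sum_i (\row_i mcoeff (mn i) P) 0 i *: e i.
  move=> sP; apply/mpolyP => m.
  have [h|h] := pselect ((ldeg m, rdeg m) = (p, q)).
    by have [i <-] := (mnP m).1 h; rewrite coefe mxE.
  transitivity (0 : C); first by apply/eqP; apply/negPn/negP => /sP.
  by apply/esym/eqP; apply/negPn/negP => /suppe.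
have mulA (c : 'rV[C]_N) j : (c *m A) 0 j = mcoeff (mn' j) (laplacian0 (\sum_i c 0 i *: e i)).
  rewrite laplacian0_sum raddf_sum mxE; apply: eq_bigr => i _.
  by rewrite mxE laplacian0Z /= mcoeffZ.
have rkA : \rank A = N'.
  apply/eqP; rewrite -[_ == _]/(row_full A) -sub1mx; apply/row_subP => j.
  have [Q sQ eQ] := @laplacian0_surj R _ ord0 (mn' j).
  have [lj rj] : ((ldeg (mn' j)).+1, (rdeg (mn' j)).+1) = (p, q) by apply/mnP'; exists j.
  rewrite lj rj in sQ; apply/submxP; exists (\row_i mcoeff (mn i) Q).
  apply/rowP => k; rewrite mulA -expand// eQ mcoeffX !mxE.
  by rewrite (inj_eq mnI').
have -> : subspace_dim (@calH R al.+1 p q) = (N - N')%N.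
  rewrite -rkA; apply: (@subspace_dim_ker _ _ _ _ _ e).
    by move=> c c0; apply/rowP => i; rewrite -coefe c0 mcoeff0 mxE.
  move=> P; split=> [[/bihomogeneousP sP /laplacian_eq0 lP]|[c -> cA]].
    exists (\row_i mcoeff (mn i) P); first exact: expand.
    by apply/rowP => j; rewrite mulA -expand// lP mcoeff0 mxE.
  split; first by apply/bihomogeneousP; exact: suppe.
  apply/laplacian_eq0/mpolyP => m; rewrite mcoeff0.
  have [h|h] := pselect (((ldeg m).+1, (rdeg m).+1) = (p, q)).
    by have [j <-] := (mnP' m).1 h; rewrite -mulA cA mxE.
  by apply/eqP; apply/negPn/negP => /(bidegree_supp_laplacian0 (@suppe c)).
have NN' : (N' <= N)%N by rewrite -rkA rank_leq_row.
by rewrite dim_weight_bin// natrB// /N /N'; case: ifP.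
Qed.

(** * Zonal polynomials are harmonic *)

(** The ratio of consecutive coefficients demanded by harmonicity: it cancels neighbouring terms in
    [laplacian0_zonal_poly]. *)
Lemma disk_coefS (K : numFieldType) al p q i : (0 < al)%N -> (i < minn p q)%N ->
  disk_coef al p q i.+1 * (i.+1 * (al + p + q - i - 1))%:R =
  - (disk_coef al p q i * ((p - i) * (q - i))%:R) :> K.
Proof.
move=> al0 ipq; rewrite /disk_coef.
have ip : (i < p)%N by lia.
have iq : (i < q)%N by lia.
have -> : (p + q - i = (p + q - i.+1).+1)%N by lia.
have -> : (al + p + q - i - 1 = al + (p + q - i.+1))%N by lia.
rewrite pochhammerS exprS factS !natrM !natrD.
have bp : i.+1%:R * 'C(p, i.+1)%:R = (p - i)%:R * 'C(p, i)%:R :> K.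
  by rewrite -!natrM mul_bin_left.
have bq : i.+1%:R * 'C(q, i.+1)%:R = (q - i)%:R * 'C(q, i)%:R :> K.
  by rewrite -!natrM mul_bin_left.
set P := pochhammer _ _; set F := i`!%:R.
transitivity (- ((-1) ^+ i * P * (al%:R + (p + q - i.+1)%:R) * F *
   (i.+1%:R * 'C(p, i.+1)%:R) * (i.+1%:R * 'C(q, i.+1)%:R))); first by ring.
by rewrite bp bq; ring.
Qed.

Lemma sum_lin5 (A : comNzRingType) n (e f g h : 'I_n -> A) (K1 K2 K3 K4 K5 : A) :
  \sum_j (e j * K1 + f j * K2 + K3 + g j * K4 + h j * K5) =
  (\sum_j e j) * K1 + (\sum_j f j) * K2 + n%:R * K3 + (\sum_j g j) * K4
  + (\sum_j h j) * K5.
Proof. by rewrite !big_split/= -!mulr_suml sumr_const card_ord mulr_natl. Qed.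

Section ZonalHarmonic.
Context {R : realType} {n : nat}.
Local Notation C := R[i].
Variable eta : 'rV[C]_n.
Hypothesis eta1 : hdot eta eta = 1.

Let X (k : 'I_(n + n)) : mpoly (n + n) C := mpolyX C (mnm1 k).
Let c_ (a : C) : mpoly (n + n) C := mpolyC (n + n) a.

Definition zonal_l : mpoly (n + n) C := \sum_j c_ ((eta 0 j)^*) * X (lshift n j).
Definition zonal_r : mpoly (n + n) C := \sum_j c_ (eta 0 j) * X (rshift n j).
Definition norm2_poly : mpoly (n + n) C := \sum_j X (lshift n j) * X (rshift n j).

Lemma peval_zonal_l z : peval zonal_l z = hdot z eta.
Proof.
rewrite pevalE raddf_sum/=; apply: eq_bigr => j _.
by rewrite mevalM mevalC mevalXU conj_point_l mulrC.
Qed.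

Lemma peval_zonal_r z : peval zonal_r z = (hdot z eta)^*.
Proof.
rewrite -[conjc _]/(Num.conj _) pevalE raddf_sum/= rmorph_sum; apply: eq_bigr => j _.
rewrite mevalM mevalC mevalXU conj_point_r [RHS]rmorphM/= mulrC.
by congr (_ * _); exact/esym/conjCK.
Qed.

Lemma peval_norm2 z : peval norm2_poly z = hdot z z.
Proof.
rewrite pevalE raddf_sum/=; apply: eq_bigr => j _.
by rewrite mevalM !mevalXU conj_point_l conj_point_r.
Qed.

Let derivXU (i k : 'I_(n + n)) : mderiv i (X k) = (k == i)%:R.
Proof.
rewrite /X mderivX mnm1E; have [->|_] := eqVneq k i; last by rewrite scale0r.
rewrite scale1r (_ : mnm_sub _ _ = mnm0) ?mpolyX0//.
by apply/mnmP => l; rewrite mnmBE subnn mnm0E.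
Qed.

Let deriv_exp k (P : mpoly (n + n) C) m :
  mderiv k (P ^+ m) = m%:R * P ^+ m.-1 * mderiv k P.
Proof.
elim: m => [|m IH]; first by rewrite expr0 -mpolyC1 mderivC !mul0r.
rewrite exprS mderivM IH /=; case: m {IH} => [|m]; first by rewrite expr0; ring.
by rewrite /= exprS -[m.+2%:R]natr1; ring.
Qed.

Let deriv_sum k (a : 'I_n -> C) (f : 'I_n -> 'I_(n + n)) :
  mderiv k (\sum_j c_ (a j) * X (f j)) = \sum_j c_ (a j) * (f j == k)%:R.
Proof.
rewrite raddf_sum; apply: eq_bigr => j _.
by rewrite /= mderiv_mulC derivXU.
Qed.

Let dl_l j : mderiv (lshift n j) zonal_l = c_ ((eta 0 j)^*).
Proof.
rewrite deriv_sum (bigD1 j)//= eqxx mulr1 big1 ?addr0// => i ij.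
by rewrite eq_lshift (negbTE ij) mulr0.
Qed.

Let dl_r j : mderiv (lshift n j) zonal_r = 0.
Proof. by rewrite deriv_sum big1// => i _; rewrite eq_rlshift mulr0. Qed.

Let dr_l j : mderiv (rshift n j) zonal_l = 0.
Proof. by rewrite deriv_sum big1// => i _; rewrite eq_lrshift mulr0. Qed.

Let dr_r j : mderiv (rshift n j) zonal_r = c_ (eta 0 j).
Proof.
rewrite deriv_sum (bigD1 j)//= eqxx mulr1 big1 ?addr0// => i ij.
by rewrite eq_rshift (negbTE ij) mulr0.
Qed.

Let dl_n j : mderiv (lshift n j) norm2_poly = X (rshift n j).
Proof.
rewrite raddf_sum (bigD1 j)//= mderivM !derivXU eqxx eq_rlshift mulr0 addr0 mul1r.
rewrite big1 ?addr0// => i ij.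
by rewrite mderivM !derivXU eq_rlshift eq_lshift (negbTE ij) mulr0 mul0r addr0.
Qed.

Let dr_n j : mderiv (rshift n j) norm2_poly = X (lshift n j).
Proof.
rewrite raddf_sum (bigD1 j)//= mderivM !derivXU eqxx eq_lrshift mul0r add0r mulr1.
rewrite big1 ?addr0// => i ij.
by rewrite mderivM !derivXU eq_lrshift eq_rshift (negbTE ij) mulr0 mul0r addr0.
Qed.

(** The product rule yields five kinds of terms. Summation over [j] contracts the first by
    [hdot eta eta = 1] and rebuilds [zonal_l], [zonal_r] and [norm2_poly] in others; the
    multiplicities [i b], [i n], [i a] and [i (i - 1)] add up to the second coefficient. *)
Lemma laplacian0_zonal_monomial a b i :
  laplacian0 (zonal_l ^+ a * zonal_r ^+ b * norm2_poly ^+ i) =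
  (a * b)%:R *: (zonal_l ^+ a.-1 * zonal_r ^+ b.-1 * norm2_poly ^+ i) +
  (i * (a + b + n + i - 1))%:R *: (zonal_l ^+ a * zonal_r ^+ b * norm2_poly ^+ i.-1).
Proof.
pose L := zonal_l; pose L' := zonal_r; pose N := norm2_poly.
have eE : \sum_j c_ (eta 0 j) * c_ ((eta 0 j)^*) = 1.
  rewrite -mpolyC1 -eta1 /hdot /c_ raddf_sum; apply: eq_bigr => j _.
  by rewrite -mpolyCM.
pose K1 := b%:R * a%:R * (L ^+ a.-1 * L' ^+ b.-1 * N ^+ i).
pose K2 := b%:R * i%:R * (L ^+ a * L' ^+ b.-1 * N ^+ i.-1).
pose K3 := i%:R * (L ^+ a * L' ^+ b * N ^+ i.-1).
pose K4 := i%:R * a%:R * (L ^+ a.-1 * L' ^+ b * N ^+ i.-1).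
pose K5 := i%:R * i.-1%:R * (L ^+ a * L' ^+ b * N ^+ i.-2).
transitivity (\sum_j (c_ (eta 0 j) * c_ ((eta 0 j)^*) * K1
   + c_ (eta 0 j) * X (rshift n j) * K2 + K3 + c_ ((eta 0 j)^*) * X (lshift n j) * K4
   + X (lshift n j) * X (rshift n j) * K5)).
  apply: eq_bigr => j _.
  have nat0 m : mderiv (lshift n j) (m%:R : mpoly (n + n) C) = 0.
    by rewrite -mpolyC_nat mderivC.
  have c0 k a' : mderiv k (c_ a') = 0 by exact: mderivC.
  rewrite !(mderivM, mderivD, deriv_exp, dl_l, dl_r, dr_l, dr_r, dl_n, dr_n, nat0, c0).
  rewrite derivXU eqxx mulr1n /K1 /K2 /K3 /K4 /K5.
  by rewrite -/L -/L' -/N; ring.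
rewrite sum_lin5 eE -/zonal_l -/zonal_r -/norm2_poly -/L -/L' -/N.
rewrite /K1 /K2 /K3 /K4 /K5.
have natE m (P : mpoly (n + n) C) : (m%:R : C) *: P = m%:R * P.
  by rewrite scaler_nat mulr_natl.
rewrite !natE; clear K1 K2 K3 K4 K5 natE; move: L L' N => L L' N.
(* The factor [m] makes this valid at [m = 0], where the exponent [m.-1] truncates. *)
have eS m (P : mpoly (n + n) C) : m%:R * P ^+ m = P * (m%:R * P ^+ m.-1).
  by case: m => [|m]; rewrite ?mul0r ?mulr0//= exprS mulrCA.
have e2 : L' * (b%:R * i%:R * (L ^+ a * L' ^+ b.-1 * N ^+ i.-1)) =
    b%:R * i%:R * (L ^+ a * L' ^+ b * N ^+ i.-1).
  transitivity ((L' * (b%:R * L' ^+ b.-1)) * (i%:R * L ^+ a * N ^+ i.-1)); first by ring.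
  by rewrite -eS; ring.
have e4 : L * (i%:R * a%:R * (L ^+ a.-1 * L' ^+ b * N ^+ i.-1)) =
    a%:R * i%:R * (L ^+ a * L' ^+ b * N ^+ i.-1).
  transitivity ((L * (a%:R * L ^+ a.-1)) * (i%:R * L' ^+ b * N ^+ i.-1)); first by ring.
  by rewrite -eS; ring.
have e5 : N * (i%:R * i.-1%:R * (L ^+ a * L' ^+ b * N ^+ i.-2)) =
    i%:R * i.-1%:R * (L ^+ a * L' ^+ b * N ^+ i.-1).
  transitivity ((N * (i.-1%:R * N ^+ i.-1.-1)) * (i%:R * L ^+ a * L' ^+ b)); first by ring.
  by rewrite -eS; ring.
rewrite e2 e4 e5; case: (i) => [|j]; first by rewrite mul0n; ring.
by rewrite /= addnS subn1 /= natrM -[j.+1%:R]natr1 !natrD !natrM; ring.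
Qed.

(** [disk_sum] made bihomogeneous: the missing degree [(i, i)] is supplied by [|z|^(2i)], which is
    [1] on the sphere. *)
Definition zonal_poly al p q : mpoly (n + n) C :=
  \sum_(i < (minn p q).+1) disk_coef al p q i *:
    (zonal_l ^+ (p - i) * zonal_r ^+ (q - i) * norm2_poly ^+ i).

(** The term of index [i] is sent to monomials of index [i] and [i - 1], and contributions to the
    same monomial cancel. The ends vanish because [minn p q] is one of [p], [q], and because of the
    factor [i] at [i = 0]. *)
Lemma laplacian0_zonal_poly al p q : (0 < al)%N -> n = al.+1 ->
  laplacian0 (zonal_poly al p q) = 0.
Proof.
move=> al0 nE; rewrite laplacian0_sum.
pose m i := zonal_l ^+ (p - i).-1 * zonal_r ^+ (q - i).-1 * norm2_poly ^+ i.
pose c i : C := disk_coef al p q i.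
transitivity (\sum_(i < (minn p q).+1) ((c i * ((p - i) * (q - i))%:R) *: m i
  + (c i * (i * (al + p + q - i))%:R) *: m i.-1)).
  apply: eq_bigr => i _; have := ltn_ord i; rewrite ltnS => im.
  rewrite laplacian0Z laplacian0_zonal_monomial scalerDr !scalerA; congr (_ + _).
  case: (nat_of_ord i) im => [|j] jm; first by rewrite !mul0n !mulr0 !scale0r.
  rewrite /m /=; congr (_ *: (_ * _ * _)).
  - by congr (_ * (_ * _)%:R); lia.
  - by congr (_ ^+ _); lia.
  - by congr (_ ^+ _); lia.
rewrite big_split/= big_ord_recr/= [X in _ + X]big_ord_recl/= mul0n mulr0 scale0r add0r.
have -> : ((p - minn p q) * (q - minn p q) = 0)%N by lia.
rewrite mulr0 scale0r addr0 -big_split/= big1// => i _.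
rewrite -scalerDl /c (_ : bump 0 i = i.+1)//.
have -> : (al + p + q - i.+1 = al + p + q - i - 1)%N by lia.
by rewrite disk_coefS// subrr scale0r.
Qed.

Lemma peval_zonal_poly al p q z : peval (zonal_poly al p q) z =
  \sum_(i < (minn p q).+1) disk_coef al p q i *
    (hdot z eta ^+ (p - i) * (hdot z eta)^* ^+ (q - i)) * hdot z z ^+ i.
Proof.
rewrite pevalE raddf_sum/=; apply: eq_bigr => i _.
rewrite mevalZ !mevalM !rmorphXn/= -!pevalE.
by rewrite peval_zonal_l peval_zonal_r peval_norm2 mulrA.
Qed.

End ZonalHarmonic.

Lemma hdotZl (R : realType) n (c : R[i]) (z w : 'rV[R[i]]_n) :
  hdot (c *: z) w = c * hdot z w.
Proof. by rewrite /hdot mulr_sumr; apply: eq_bigr => j _; rewrite mxE mulrA. Qed.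

Lemma hdot_normE (R : realType) n (z : 'rV[R[i]]_n) :
  hdot z z = ((hnorm z) ^+ 2)%:C.
Proof.
have h0 : 0 <= hdot z z by apply: sumr_ge0 => j _; rewrite mul_conjC_ge0.
rewrite /hnorm sqr_sqrtr; last first.
  by move: h0; case: (hdot z z) => a b /andP[_].
by move: h0; case: (hdot z z) => a b /andP[/eqP /= -> _].
Qed.

Lemma usphere_hdot (R : realType) n (z : 'rV[R[i]]_n) :
  usphere z -> hdot z z = 1.
Proof. by rewrite hdot_normE => ->; rewrite expr1n. Qed.

Lemma zonalE (R : realType) al p q (eta xi : 'rV[R[i]]_al.+1) : (0 < al)%N ->
  zonal p q eta xi = disk al (hdot xi eta) (hdot xi eta)^* p q.
Proof.
move=> al0; rewrite -zonal_disk_sum// /zonal.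
have e1 : al.+1%:R - 1 = al%:R :> R[i] by rewrite -natr1 addrK.
have e2 : - (al.+1%:R - 2) = 1 - al%:R :> R[i] by rewrite -natr1; ring.
by rewrite e1 e2.
Qed.

Lemma zonal_sphH (R : realType) al p q (eta : 'rV[R[i]]_al.+1) (c : R[i]) :
  (0 < al)%N -> usphere eta -> sphH p q (fun xi => c * zonal p q eta xi).
Proof.
move=> al0 /usphere_hdot eta1.
pose d : R[i] := c / (pochhammer al%:R p * pochhammer al%:R q).
exists (d *: zonal_poly eta al p q); last first.
  move=> xi /usphere_hdot xi1; rewrite zonalE// pevalE mevalZ -pevalE.
  rewrite peval_zonal_poly /disk mulrA mulrAC -/d; congr (_ * _).
  apply: eq_bigr => i _.
  by rewrite xi1 expr1n mulr1.
split; last by apply/laplacian_eq0; rewrite laplacian0Z laplacian0_zonal_poly// scaler0.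
move=> lam z; rewrite !pevalE !mevalZ -!pevalE !peval_zonal_poly mulrCA; congr (_ * _).
rewrite mulr_sumr; apply: eq_bigr => i _; have := ltn_ord i; rewrite ltnS leq_min => /andP[ip iq].
have -> : hdot (lam *: z) (lam *: z) = lam * lam^* * hdot z z.
  by rewrite hdotZl /hdot !mulr_sumr; apply: eq_bigr => j _; rewrite !mxE rmorphM; ring.
rewrite hdotZl rmorphM !exprMn.
have -> : lam ^+ p = lam ^+ (p - i) * lam ^+ i by rewrite -exprD subnK.
have -> : lam^* ^+ q = lam^* ^+ (q - i) * lam^* ^+ i :> R[i] by rewrite -exprD subnK.
by rewrite /=; ring.
Qed.

(** * Real series and the hypergeometric function *)

Lemma disk_gamma0 (K : numFieldType) k : disk_gamma 0 k = (k == 0%N)%:R :> K.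
Proof.
case: k => [|k]; first by rewrite /disk_gamma pochhammer0 divr1.
by rewrite /disk_gamma pochhammer_recl !mul0r.
Qed.

Lemma disk_gamma_ge0 (K : numFieldType) n k : 0 <= disk_gamma n k :> K.
Proof.
case: n => [|n]; first by rewrite disk_gamma0 ler0n.
by rewrite ltW// disk_gamma_gt0.
Qed.

(** The truncated form of [(1 - z) (1 - z)^(-n-1) = (1 - z)^(-n)], by Pascal's rule for
    [disk_gamma]. It drives the inductions on [n] for the bound and for the remainder. *)
Lemma binomial_sum_rec (K : numFieldType) n N (z : K) :
  (1 - z) * (\sum_(k < N.+1) disk_gamma n.+1 k * z ^+ k) =
  \sum_(k < N.+1) disk_gamma n k * z ^+ k - disk_gamma n.+1 N * z ^+ N.+1.
Proof.
elim: N => [|N IH].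
  by rewrite !big_ord1 /disk_gamma !pochhammer0 fact0; field.
rewrite [in LHS]big_ord_recr mulrDr IH [in RHS]big_ord_recr/=.
have g : disk_gamma n.+1 N.+1 - disk_gamma n.+1 N = disk_gamma n N.+1 :> K.
  rewrite /disk_gamma (pochhammer_recl n%:R) pochhammerS natr1 factS natrM.
  have f0 : N`!%:R != 0 :> K by rewrite pnatr_eq0 -lt0n fact_gt0.
  by field; rewrite f0 nat1r pnatr_eq0.
by rewrite -g !exprS; ring.
Qed.

Lemma binomial_sum_le (K : numFieldType) n N (z : K) : 0 <= z -> z < 1 ->
  \sum_(k < N) disk_gamma n k * z ^+ k <= (1 - z) ^- n.
Proof.
move=> z0 z1; have z1' : 0 < 1 - z by rewrite subr_gt0.
elim: n => [|n IH].
  rewrite expr0 invr1; case: N => [|N]; first by rewrite big_ord0.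
  rewrite big_ord_recl disk_gamma0 eqxx mulr1 big1 ?addr0// => k _.
  by rewrite disk_gamma0 mul0r.
rewrite exprS invfM [X in _ <= X]mulrC ler_pdivlMr// mulrC.
case: N IH => [|N] IH; first by rewrite big_ord0 mulr0 invr_ge0 exprn_ge0// ltW.
rewrite binomial_sum_rec; apply: le_trans IH.
by rewrite gerBl mulr_ge0 ?disk_gamma_ge0 ?exprn_ge0.
Qed.

Lemma binomial_term_le (K : numFieldType) n k (z : K) : 0 <= z -> z < 1 ->
  disk_gamma n k * z ^+ k <= (1 - z) ^- n.
Proof.
move=> z0 z1; apply: le_trans (binomial_sum_le n k.+1 z0 z1).
rewrite big_ord_recr/= lerDr sumr_ge0// => i _.
by rewrite mulr_ge0 ?disk_gamma_ge0 ?exprn_ge0.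
Qed.

Lemma binomial_series_error (K : numFieldType) n (r rho : K) :
  0 <= r -> r < rho -> rho < 1 ->
  exists2 M : K, 0 <= M & forall N z, `|z| <= r ->
    `|1 - (1 - z) ^+ n * (\sum_(k < N) disk_gamma n k * z ^+ k)| <= M * (r / rho) ^+ N.
Proof.
move=> r0 rrho rho1; have rho0 : 0 < rho by exact: le_lt_trans rrho.
have th0 : 0 <= r / rho by rewrite divr_ge0// ltW.
have rho1' : 0 < 1 - rho by rewrite subr_gt0.
elim: n => [|n [M M0 IH]].
  exists 1 => // N z zr; case: N => [|N].
    by rewrite big_ord0 mulr0 subr0 normr1 mul1r.
  rewrite big_ord_recl disk_gamma0 eqxx big1 => [|k _].
    by rewrite addr0 !mulr1 subrr normr0 mul1r exprn_ge0.
  by rewrite disk_gamma0 mul0r.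
(* [M] comes from the induction and [1] settles [N = 0]. The last summand bounds the boundary term,
   through [|1 - z| <= 2] and [binomial_term_le] at [rho]. *)
exists (M + 1 + 2 ^+ n * (1 - rho) ^- n.+1).
  by rewrite !addr_ge0 ?mulr_ge0 ?exprn_ge0 ?invr_ge0 ?exprn_ge0// ltW.
case=> [|N] z zr.
  rewrite big_ord0 mulr0 subr0 normr1 mulr1 [_ + 1]addrC -addrA lerDl.
  by rewrite addr_ge0// mulr_ge0 ?exprn_ge0 ?invr_ge0 ?exprn_ge0// ltW.
rewrite exprSr -mulrA binomial_sum_rec.
set S := \sum_(_ < _) _; set G := disk_gamma _ _ * _; set c := 2 ^+ n * _.
rewrite (_ : 1 - _ = 1 - (1 - z) ^+ n * S + (1 - z) ^+ n * G); last by ring.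
apply: le_trans (ler_normD _ _) _.
apply: (@le_trans _ _ (M * (r / rho) ^+ N.+1 + c * (r / rho) ^+ N.+1)); last first.
  by rewrite -mulrDl ler_wpM2r ?exprn_ge0// lerD2r lerDl.
rewrite lerD ?IH// /G /c.
rewrite -[X in _ <= X]mulrA normrM normrX ler_pM ?exprn_ge0//.
  rewrite lerXn2r ?nnegrE//; apply: le_trans (ler_normB _ _) _.
  by rewrite normr1 -[2]/(1 + 1) lerD// (le_trans zr)// (le_trans (ltW rrho))// ltW.
rewrite normrM normrX (ger0_norm (disk_gamma_ge0 _ _ _)).
have g := @binomial_term_le K n.+1 N rho (ltW rho0) rho1.
apply: (@le_trans _ _ (disk_gamma n.+1 N * rho ^+ N * (r / rho) ^+ N.+1)); last first.
  by rewrite ler_wpM2r ?exprn_ge0.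
rewrite -mulrA ler_wpM2l ?disk_gamma_ge0// [(r / rho) ^+ _]exprSr mulrA -exprMn.
rewrite [rho * _]mulrC divfK ?gt_eqF//.
rewrite exprSr ler_pM ?exprn_ge0//; first by rewrite lerXn2r ?nnegrE.
by rewrite ler_pdivlMr// (le_trans _ zr)// ler_piMr// ltW.
Qed.

Section RealSeries.
Context {R : realType}.
Implicit Types a b : R^nat.

Lemma ler_sum_widen m M (f : nat -> R) : (forall i, 0 <= f i) -> (m <= M)%N ->
  \sum_(i < m) f i <= \sum_(i < M) f i.
Proof.
move=> f0 mM; rewrite (big_ord_widen M f mM).
by rewrite [X in _ <= X](bigID (fun i : 'I_M => (i < m)%N))/= lerDl sumr_ge0.
Qed.

Lemma cvg_series_ge0 a (M : R) : (forall k, 0 <= a k) ->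
  (forall N, series a N <= M) -> cvgn (series a).
Proof.
move=> a0 aM; apply: nondecreasing_is_cvgn; last by exists M => _ [N _ <-].
by apply: nondecreasing_series => k _ _.
Qed.

Lemma series_ge0_le_lim a N : (forall k, 0 <= a k) -> cvgn (series a) ->
  series a N <= limn (series a).
Proof.
move=> a0 ca; apply: nondecreasing_cvgn_le ca N.
by apply: nondecreasing_series => k _ _.
Qed.

Lemma lim_series_le a (M : R) : cvgn (series a) ->
  (forall N, series a N <= M) -> limn (series a) <= M.
Proof. by move=> ca aM; apply: limr_le ca _; apply: nearW. Qed.

(** For nonnegative terms the triangle of size [N] lies in the square of size [N], which lies in the
    triangle of size [2 N]; this squeezes the partial sums. *)
Lemma cauchy_product a b (A B : R) : (forall k, 0 <= a k) -> (forall k, 0 <= b k) ->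
  series a @ \oo --> A -> series b @ \oo --> B ->
  series (fun k => \sum_(j < k.+1) a (k - j)%N * b j) @ \oo --> A * B.
Proof.
move=> a0 b0 aA bB; set c := (fun k => _).
have c0 k : 0 <= c k by apply: sumr_ge0 => j _; rewrite mulr_ge0.
have [ca cb] : cvgn (series a) /\ cvgn (series b) by split; apply/cvg_ex; [exists A|exists B].
have cE N : series c N = \sum_(j < N) \sum_(i < N - j) a i * b j.
  rewrite seriesEord/= /c -(big_triangle (fun j k => a (k - j)%N * b j)).
  by apply: eq_bigr => j _; apply: eq_bigr => i _; rewrite addKn.
have cU N : series c N <= series a N * series b N.
  rewrite cE !seriesEord/= mulr_sumr; apply: ler_sum => j _; rewrite mulr_suml.
  by apply: (@ler_sum_widen _ _ (fun i => a i * b j)); rewrite ?leq_subr// => i; rewrite mulr_ge0.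
have cL N : series a N * series b N <= series c (N + N)%N.
  rewrite cE !seriesEord/= mulr_sumr.
  apply: (@le_trans _ _ (\sum_(j < N) \sum_(i < N + N - j) a i * b j)).
    apply: ler_sum => j _; rewrite mulr_suml.
    apply: (@ler_sum_widen _ _ (fun i => a i * b j)) => [i|]; first by rewrite mulr_ge0.
    by rewrite -addnBA ?leq_addr// ltnW.
  apply: (@ler_sum_widen _ _ (fun j => \sum_(i < N + N - j) a i * b j)); rewrite ?leq_addr// => j.
  by rewrite sumr_ge0// => i _; rewrite mulr_ge0.
have AE : limn (series a) = A by exact: cvg_lim.
have BE : limn (series b) = B by exact: cvg_lim.
have sa0 N : 0 <= series a N by rewrite sumr_ge0.
have sb0 N : 0 <= series b N by rewrite sumr_ge0.
have cAB N : series c N <= A * B.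
  apply: le_trans (cU N) _; rewrite -AE -BE.
  by rewrite ler_pM// series_ge0_le_lim.
have cc : cvgn (series c) by exact: cvg_series_ge0 cAB.
suff <- : limn (series c) = A * B by [].
apply/eqP; rewrite eq_le lim_series_le//=.
have sAB : (fun N => series a N * series b N) @ \oo --> A * B by exact: cvgM.
rewrite -(cvg_lim _ sAB)//; apply: limr_le; first by apply/cvg_ex; exists (A * B).
by apply: nearW => N; apply: le_trans (cL N) _; exact: series_ge0_le_lim.
Qed.

Lemma binomial_series n (x : R) : 0 <= x -> x < 1 ->
  series (fun k => disk_gamma n k * x ^+ k) @ \oo --> (1 - x) ^- n.
Proof.
move=> x0 x1; pose y := (x + 1) / 2.
have xy : x < y by rewrite /y; lra.
have y1 : y < 1 by rewrite /y; lra.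
have y0 : 0 < y by exact: le_lt_trans xy.
have [M M0 MN] := @binomial_series_error R n x y x0 xy y1.
have x1' : 0 < (1 - x) ^+ n by rewrite exprn_gt0// subr_gt0.
have th0 : 0 <= x / y by rewrite divr_ge0// ltW.
have th : `|x / y| < 1 by rewrite ger0_norm// ltr_pdivrMr// mul1r.
have e0 : (fun N => M * (x / y) ^+ N) @ \oo --> (0 : R).
  by rewrite -(mulr0 M); apply: cvgMr; exact: cvg_expr.
have : (fun N => 1 - (1 - x) ^+ n * series (fun k => disk_gamma n k * x ^+ k) N) @ \oo --> (0 : R).
  apply/cvgr0Pnorm_le => e e_gt0.
  have /cvgr0Pnorm_le/(_ _ e_gt0) := e0; apply: filterS => N /= h.
  rewrite seriesEord/=; apply: le_trans (MN N x _) _; first by rewrite ger0_norm.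
  by apply: le_trans h; exact: ler_norm.
move=> h.
rewrite [X in X @ _ --> _](_ : _ = fun N => (1 - x) ^- n *
  (1 - (1 - (1 - x) ^+ n * series (fun k => disk_gamma n k * x ^+ k) N))); last first.
  by apply/funext => N; rewrite opprB addrCA subrr addr0 mulKf// gt_eqF.
rewrite -[X in _ --> X]mulr1 -[X in _ * X](subr0 1); apply: cvgMr.
by apply: cvgB => //; exact: cvg_cst.
Qed.

(* Comparing with the sum at a larger point gives a geometric tail. *)
Lemma power_series_tail (e : R^nat) (x y B : R) m : (forall k, 0 <= e k) ->
  0 <= x -> x <= y -> 0 < y -> (forall N, series (fun k => e k * y ^+ k) N <= B) ->
  cvgn (series (fun k => e k * x ^+ k)) /\
  0 <= limn (series (fun k => e k * x ^+ k)) - \sum_(k < m) e k * x ^+ k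
    <= (x / y) ^+ m * B.
Proof.
move=> e0 x0 xy y0 eB.
have t0 k : 0 <= e k * x ^+ k by rewrite mulr_ge0 ?exprn_ge0.
have th0 : 0 <= x / y by rewrite divr_ge0// ltW.
have th1 : x / y <= 1 by rewrite ler_pdivrMr// mul1r.
have tail N : \sum_(k < m + N) e k * x ^+ k <= \sum_(k < m) e k * x ^+ k + (x / y) ^+ m * B.
  rewrite big_split_ord/= lerD2l; apply: (@le_trans _ _ ((x / y) ^+ m * \sum_(k < m + N) e k * y ^+ k)).
    rewrite big_split_ord/= mulrDr -[X in X <= _]add0r lerD//.
      rewrite mulr_ge0 ?exprn_ge0// sumr_ge0// => k _.
      by rewrite mulr_ge0 ?exprn_ge0// ltW.
    rewrite mulr_sumr; apply: ler_sum => k _; rewrite mulrCA ler_wpM2l//.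
    rewrite -{1}(divfK (lt0r_neq0 y0) x) exprMn ler_wpM2r ?exprn_ge0 ?(ltW y0)//.
    by rewrite ler_wiXn2l// leq_addr.
  rewrite ler_wpM2l ?exprn_ge0//.
  by have := eB (m + N)%N; rewrite seriesEord.
have tail' N : series (fun k => e k * x ^+ k) N <=
    \sum_(k < m) e k * x ^+ k + (x / y) ^+ m * B.
  rewrite seriesEord/=; apply: le_trans (tail N).
  exact: (@ler_sum_widen N (m + N)%N (fun k => e k * x ^+ k)) t0 (leq_addl _ _).
have cx : cvgn (series (fun k => e k * x ^+ k)) by exact: cvg_series_ge0 tail'.
split=> //; rewrite subr_ge0 lerBlDl; apply/andP; split; last exact: lim_series_le.
by have := series_ge0_le_lim m t0 cx; rewrite seriesEord.
Qed.

End RealSeries.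

(** * Gauss's summation and Euler's transformation *)

Section Hypergeometric.
Context {R : realType}.

Lemma pochhammer_nat_ge0 (m k : nat) : 0 <= pochhammer m%:R k :> R.
Proof. by apply: prodr_ge0 => j _; rewrite addr_ge0. Qed.

Lemma hyp2F1_coef_ge0 (a b c k : nat) :
  0 <= pochhammer a%:R k * pochhammer b%:R k / pochhammer c%:R k :> R.
Proof. by rewrite !mulr_ge0 ?invr_ge0 ?pochhammer_nat_ge0. Qed.

Lemma hyp2F1_term_ge0 (a b c : nat) (x : R) k : 0 <= x ->
  0 <= hyp2F1_term a%:R b%:R c%:R x k.
Proof.
by move=> x0; rewrite mulr_ge0 ?hyp2F1_coef_ge0 ?divr_ge0 ?exprn_ge0.
Qed.

Lemma pochhammerD (x : R) j m :
  pochhammer x (j + m) = pochhammer x j * pochhammer (x + j%:R) m.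
Proof.
elim: m => [|m IH]; first by rewrite addn0 pochhammer0 mulr1.
by rewrite addnS !pochhammerS IH natrD; ring.
Qed.

Let f0 k : k`!%:R != 0 :> R. Proof. by rewrite pnatr_eq0 -lt0n fact_gt0. Qed.

(** The quotient of factorials is at most [1 / (N + 1)]: this is the decay of the boundary term of
    [gauss_telescope]. *)
Lemma fact_ratio_le (a b N : nat) :
  ((a + N)`! * (b + N)`! * N.+1 <= (a + b + 1 + N)`! * N`!)%N.
Proof.
elim: b => [|b IH].
  rewrite add0n addn0 addn1 addSn factS mulnAC leq_mul2r.
  by rewrite mulnC leq_mul2r ltnS leq_addl orbT orbT.
have -> : (a + b.+1 + 1 + N = (a + b + 1 + N).+1)%N by lia.
rewrite addSn !factS.
move: (a + N)`! (b + N)`! (a + b + 1 + N)`! N`! IH => X Y Z W IH.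
by rewrite mulnCA -!mulnA leq_mul ?mulnA//; lia.
Qed.

Let pE (a k : nat) : pochhammer a.+1%:R k = (a + k)`!%:R / a`!%:R :> R.
Proof. by rewrite -pochhammer_fact mulfK. Qed.

Lemma gauss_remainder (a b c : nat) : (a + b + 1 < c)%N ->
  (fun N => pochhammer (a%:R + 1) N * pochhammer b%:R N.+1
     / (pochhammer c%:R N * N`!%:R)) @ \oo --> (0 : R).
Proof.
case: c => // c; rewrite ltnS => abc.
case: b abc => [|b] abc.
  rewrite (_ : (fun N => _) = cst 0); first exact: cvg_cst.
  by apply/funext => N /=; rewrite pochhammer_recl mul0r mulr0 mul0r.
apply: (@squeeze_cvgr _ _ _ _ (cst 0) (fun N => c`!%:R / a`!%:R / b`!%:R * harmonic N)).
- apply: nearW => N; rewrite natr1 !pE /=; apply/andP; split.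
    by rewrite !mulr_ge0 ?invr_ge0 ?mulr_ge0.
  rewrite addnS -addSn.
  have h : (a + N)`!%:R * (b.+1 + N)`!%:R * N.+1%:R <= (c + N)`!%:R * N`!%:R :> R.
    rewrite -!natrM ler_nat; apply: leq_trans (fact_ratio_le a b.+1 N) _.
    by rewrite leq_mul2r leq_fact ?orbT// leq_add2r.
  have -> : (a + N)`!%:R / a`!%:R * ((b.+1 + N)`!%:R / b`!%:R)
      / ((c + N)`!%:R / c`!%:R * N`!%:R) =
    c`!%:R / a`!%:R / b`!%:R * (((a + N)`!%:R * (b.+1 + N)`!%:R)
      / ((c + N)`!%:R * N`!%:R)) :> R by field; rewrite !f0.
  rewrite ler_wpM2l ?divr_ge0// ler_pdivrMr ?mulr_gt0 ?ltr0n ?fact_gt0//.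
  by rewrite [X in _ <= X]mulrC /harmonic /= ler_pdivlMr ?ltr0n.
- exact: cvg_cst.
- rewrite -[X in _ --> X](mulr0 (c`!%:R / a`!%:R / b`!%:R)); apply: cvgMr.
  exact: cvg_harmonic.
Qed.

(** Gauss's value of [2F1] at [1] for natural parameters, by induction on [p]: for [p = 0] the
    series reduces to its first term, and the limit of [gauss_telescope] gives the step. *)
Lemma gauss_sum (p q c : nat) : (p + q < c)%N ->
  series (hyp2F1_term p%:R q%:R c%:R (1 : R)) @ \oo -->
  ((c - 1)`!%:R * (c - p - q - 1)`!%:R / ((c - p - 1)`!%:R * (c - q - 1)`!%:R) : R).
Proof.
move=> pqc; have c0 : (0 < c)%N by lia.
elim: p pqc => [|p IH] pqc.
  rewrite subn0 mulfV ?mulf_neq0//.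
  rewrite -(cvg_shiftS _) (_ : [sequence _]_ _ = cst 1); first exact: cvg_cst.
  apply/funext => N /=; rewrite seriesEord/= big_ord_recl big1 ?addr0 => [|k _].
    by rewrite /hyp2F1_term !pochhammer0 expr0 fact0 !mulr1 !invr1 !mulr1.
  by rewrite /hyp2F1_term /bump pochhammer_recl !mul0r.
have {}IH := IH (ltnW pqc).
have pc k : pochhammer c%:R k != 0 :> R by rewrite gt_eqF// pochhammer_gt0 ?ltr0n.
have sE (a : R) N : series (hyp2F1_term a q%:R c%:R 1) N =
    \sum_(k < N) pochhammer a k * pochhammer q%:R k / pochhammer c%:R k / k`!%:R.
  by rewrite seriesEord; apply: eq_bigr => k _; rewrite /hyp2F1_term expr1n mul1r.
have d0 : c%:R - p%:R - q%:R - 1 != 0 :> R.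
  by rewrite -[1]/(1%:R) -!natrB; [rewrite pnatr_eq0; lia|lia|lia|lia].
rewrite -(cvg_shiftS _).
rewrite [X in X @ _ --> _](_ : _ = fun N => (c%:R - p%:R - q%:R - 1)^-1 *
   ((c%:R - p%:R - 1) * series (hyp2F1_term p%:R q%:R c%:R (1 : R)) N.+1
    - pochhammer (p%:R + 1) N * pochhammer q%:R N.+1 / (pochhammer c%:R N * N`!%:R))); last first.
  by apply/funext => N /=; rewrite !sE -gauss_telescope// mulKf// natr1.
have -> : (c - 1)`!%:R * (c - p.+1 - q - 1)`!%:R / ((c - p.+1 - 1)`!%:R * (c - q - 1)`!%:R) =
  (c%:R - p%:R - q%:R - 1)^-1 * ((c%:R - p%:R - 1) *
   ((c - 1)`!%:R * (c - p - q - 1)`!%:R / ((c - p - 1)`!%:R * (c - q - 1)`!%:R)) - 0) :> R.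
  have e1 : (c - p - q - 1 = (c - p.+1 - q - 1).+1)%N by lia.
  have e2 : (c - p - 1 = (c - p.+1 - 1).+1)%N by lia.
  have e3 : c%:R - p%:R - q%:R - 1 = (c - p.+1 - q - 1).+1%:R :> R.
    by rewrite -e1 !natrB//; lia.
  have e4 : c%:R - p%:R - 1 = (c - p.+1 - 1).+1%:R :> R.
    by rewrite -e2 !natrB//; lia.
  rewrite e1 e2 e3 e4 !factS !natrM; field.
  by rewrite !f0 !nat1r !pnatr_eq0.
apply: cvgMr; apply: cvgB; last by apply: gauss_remainder; lia.
by apply: cvgMr; rewrite (cvg_shiftS (series _)).
Qed.

Section Coefficients.
Variables (al p q : nat).

Let c : nat := (p + q + al.+1)%N.

(** The value [2F1(p, q; p + q + al + 1; 1)]. Its inverse is the factorial prefactor of [Snpq]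
    divided by [(p + q + al)!], hence the second form of [Snpq]. *)
Definition gauss_const : R :=
  (p + q + al)`!%:R * al`!%:R / ((p + al)`!%:R * (q + al)`!%:R).

Lemma gauss_const_gt0 : 0 < gauss_const.
Proof. by rewrite divr_gt0 ?mulr_gt0 ?ltr0n ?fact_gt0. Qed.

Lemma hyp2F1_at1_cvg :
  series (hyp2F1_term p%:R q%:R c%:R (1 : R)) @ \oo --> gauss_const.
Proof.
have := @gauss_sum p q c; rewrite /c.
have -> : (p + q + al.+1 - 1 = p + q + al)%N by lia.
have -> : (p + q + al.+1 - p - q - 1 = al)%N by lia.
have -> : (p + q + al.+1 - p - 1 = q + al)%N by lia.
have -> : (p + q + al.+1 - q - 1 = p + al)%N by lia.
by rewrite /gauss_const [X in _ / X]mulrC; apply; lia.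
Qed.

Lemma hyp2F1_cvg (x : R) : 0 <= x -> x <= 1 ->
  cvgn (series (hyp2F1_term p%:R q%:R c%:R x)) /\
  hyp2F1 p%:R q%:R c%:R x <= gauss_const.
Proof.
move=> x0 x1; have h1 := hyp2F1_at1_cvg.
have c1 : cvgn (series (hyp2F1_term p%:R q%:R c%:R (1 : R))).
  by apply/cvg_ex; exists gauss_const.
have cB N : series (hyp2F1_term p%:R q%:R c%:R x) N <= gauss_const.
  rewrite -(cvg_lim _ h1)//; apply: (@le_trans _ _ (series (hyp2F1_term p%:R q%:R c%:R 1) N)).
    apply: ler_sum => k _; rewrite /hyp2F1_term ler_wpM2l ?hyp2F1_coef_ge0//.
    by rewrite expr1n ler_wpM2r ?invr_ge0// exprn_ile1.
  by apply: series_ge0_le_lim => // k; apply: hyp2F1_term_ge0.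
have cc : cvgn (series (hyp2F1_term p%:R q%:R c%:R x)).
  by apply: cvg_series_ge0 cB => k; apply: hyp2F1_term_ge0.
by split=> //; exact: lim_series_le.
Qed.

Lemma fact_quotE d k : fact_quot d k = pochhammer d%:R k :> R.
Proof.
by case: d => [|d]//; rewrite /fact_quot addSn !subn1/= pE.
Qed.

Lemma Snpq_termE (r : R) k : Snpq_term al.+1 p q r k =
  ((p + q + al)`!%:R)^-1 * hyp2F1_term p%:R q%:R c%:R (r ^+ 2) k.
Proof.
rewrite /Snpq_term /hyp2F1_term !fact_quotE /c addnS pE exprM.
have -> : (al.+1 - 1 + p + q + k = p + q + al + k)%N by lia.
by field; rewrite !f0.
Qed.

Lemma series_scale (u : R^nat) (a : R) N :
  series (fun k => a * u k) N = a * series u N.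
Proof. by rewrite !seriesEord/= mulr_sumr. Qed.

Lemma Snpq_term_cvg (r : R) : 0 <= r -> r < 1 ->
  series (Snpq_term al.+1 p q r) @ \oo -->
  ((p + q + al)`!%:R)^-1 * hyp2F1 p%:R q%:R c%:R (r ^+ 2).
Proof.
move=> r0 r1.
rewrite (_ : series _ = fun N => ((p + q + al)`!%:R)^-1 *
  series (hyp2F1_term p%:R q%:R c%:R (r ^+ 2)) N); last first.
  apply/funext => N; rewrite -series_scale; congr (series _ N).
  by apply/funext => k; rewrite Snpq_termE.
apply: cvgMr; rewrite /hyp2F1.
have r20 : 0 <= r ^+ 2 by rewrite exprn_ge0.
have r21 : r ^+ 2 <= 1 by rewrite exprn_ile1// ltW.
exact: (hyp2F1_cvg r20 r21).1.
Qed.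

Lemma SnpqE (r : R) : 0 <= r -> r < 1 ->
  Snpq al.+1 p q r = r ^+ (p + q) * (hyp2F1 p%:R q%:R c%:R (r ^+ 2) / gauss_const).
Proof.
move=> r0 r1; rewrite /Snpq (cvg_lim _ (Snpq_term_cvg r0 r1))//.
by rewrite /gauss_const !addnS !subn1/=; field; rewrite !f0.
Qed.

(** The Cauchy product of the series of [(1 - x)^(-n)] and [2F1(p, q; p + q + n; x)], for
    [n = al + 1]; [saalschuetz] at [x = n] evaluates its coefficients. *)
Lemma euler_transform (x : R) : 0 <= x -> x < 1 ->
  series (fun k => euler_coef al p q k * x ^+ k) @ \oo -->
  (1 - x) ^- al.+1 * (hyp2F1 p%:R q%:R c%:R x / gauss_const).
Proof.
move=> x0 x1; rewrite mulrA mulrC.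
have [cF _] := hyp2F1_cvg x0 (ltW x1).
have c0 : (0 < c)%N by rewrite /c addnS.
rewrite [X in X @ _ --> _](_ : _ = fun N => gauss_const^-1 * series (fun k =>
   \sum_(j < k.+1) disk_gamma al.+1 (k - j) * x ^+ (k - j) *
      hyp2F1_term p%:R q%:R c%:R x j) N); last first.
  apply/funext => N; rewrite -series_scale; congr (series _ N); apply/funext => k.
  have pc j : pochhammer c%:R j != 0 :> R by rewrite gt_eqF// pochhammer_gt0 ?ltr0n.
  transitivity (gauss_const^-1 * (x ^+ k / k`!%:R / pochhammer c%:R k *
    (pochhammer (p%:R + al.+1%:R) k * pochhammer (q%:R + al.+1%:R) k))).
    rewrite -!natrD {1}/c !addnS !pE /euler_coef /gauss_const.
    by field; rewrite !f0.
  rewrite -saalschuetz mulr_sumr; congr (_ * _); apply: eq_bigr => j _.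
  have jk : (j <= k)%N by rewrite -ltnS.
  rewrite /disk_gamma /hyp2F1_term bin_factE// -!natrD -/c.
  have -> : x ^+ k = x ^+ (k - j) * x ^+ j by rewrite -exprD subnK.
  have e : pochhammer c%:R k = pochhammer c%:R j * pochhammer (c%:R + j%:R) (k - j) :> R.
    by rewrite -pochhammerD subnKC.
  have := pc k; rewrite e mulf_eq0 negb_or natrD => /andP[pj pkj].
  by field; rewrite !f0 pj pkj.
apply: cvgMr; apply: (@cauchy_product _ (fun k => disk_gamma al.+1 k * x ^+ k)
  (hyp2F1_term p%:R q%:R c%:R x)) => [k|k| |].
- by rewrite mulr_ge0 ?disk_gamma_ge0 ?exprn_ge0.
- exact: hyp2F1_term_ge0.
- exact: binomial_series.
- exact: cF.
Qed.

End Coefficients.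
End Hypergeometric.

(** * The uniform estimate *)

Lemma sum_ord_trunc (V : nmodType) (f : nat -> V) m N : (m <= N)%N ->
  \sum_(k < m) f k = \sum_(k < N) if (k < m)%N then f k else 0.
Proof. by move=> mN; rewrite (big_ord_widen N f mN) big_mkcond. Qed.

Lemma sum_ord_shift (V : nmodType) (f : nat -> V) k N :
  \sum_(a < N) (if (k <= a)%N then f (a - k)%N else 0) =
  \sum_(p < N) (if (p < N - k)%N then f p else 0).
Proof.
rewrite -(sum_ord_trunc f (leq_subr k N)).
rewrite -(big_mkord xpredT (fun a => if (k <= a)%N then f (a - k)%N else 0)).
have [Nk|kN] := leqP N k.
  rewrite (eqP Nk) big_ord0 big_nat big1// => a /andP[_ aN].
  by rewrite leqNgt (leq_trans aN Nk).
rewrite (big_cat_nat (n := k))//=; last exact: ltnW.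
rewrite big_nat big1 ?add0r => [|a /andP[_ ak]]; last by rewrite leqNgt ak.
rewrite -{1}(add0n k) big_addn big_mkord; apply: eq_bigr => i _.
by rewrite leq_addl addnK.
Qed.

(** The substitution [(a, b) = (p + k, q + k)]: both indices stay below [N] exactly when
    [k < N - maxn p q]. *)
Lemma sum_diagonals (V : nmodType) (phi : nat -> nat -> nat -> V) N :
  \sum_(a < N) \sum_(b < N) \sum_(k < (minn a b).+1) phi (a - k)%N (b - k)%N k =
  \sum_(p < N) \sum_(q < N) \sum_(k < N - maxn p q) phi p q k.
Proof.
transitivity (\sum_(k < N) \sum_(a < N) \sum_(b < N)
    if (k <= a)%N && (k <= b)%N then phi (a - k)%N (b - k)%N k else 0).
  rewrite [RHS]exchange_big; apply: eq_bigr => a _; rewrite [RHS]exchange_big.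
  apply: eq_bigr => b _.
  rewrite (@sum_ord_trunc _ (fun k => phi (a - k)%N (b - k)%N k) _ N).
    by apply: eq_bigr => k _; rewrite ltnS leq_min.
  by have := ltn_ord a; lia.
transitivity (\sum_(k < N) \sum_(p < N) \sum_(q < N)
    if (p < N - k)%N && (q < N - k)%N then phi p q k else 0); last first.
  rewrite exchange_big; apply: eq_bigr => p _; rewrite exchange_big.
  apply: eq_bigr => q _.
  rewrite (@sum_ord_trunc _ (phi p q) _ N) ?leq_subr//.
  apply: eq_bigr => k _; congr (if _ then _ else _); lia.
apply: eq_bigr => k _.
transitivity (\sum_(a < N) if (k <= a)%N then
    \sum_(b < N) (if (k <= b)%N then phi (a - k)%N (b - k)%N k else 0) else 0).
  by apply: eq_bigr => a _; case: ifP => //= _; rewrite big1.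
rewrite (sum_ord_shift (fun p => \sum_(b < N) if (k <= b)%N then phi p (b - k)%N k else 0)).
apply: eq_bigr => p _; case: (p < N - k)%N => /=; last by rewrite big1.
by rewrite (sum_ord_shift (fun q => phi p q k)).
Qed.

Section WeightBound.
Context {R : realType} (al : nat) (al_gt0 : (0 < al)%N).

(** A factor [k + 1] costs one unit of the binomial exponent, since [m * disk_gamma m.+1 k = (m + k)
    * disk_gamma m k]. *)
Lemma disk_gammaS_ge m k : (0 < m)%N ->
  k.+1%:R * disk_gamma m k <= m%:R * disk_gamma m.+1 k :> R.
Proof.
move=> m0; have f0 : k`!%:R != 0 :> R by rewrite pnatr_eq0 -lt0n fact_gt0.
have -> : m%:R * disk_gamma m.+1 k = (m + k)%:R * disk_gamma m k :> R.
  rewrite /disk_gamma !mulrA -natr1 -pochhammer_recl pochhammerS natrD.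
  by rewrite [_ * (_ + _)]mulrC.
by rewrite ler_wpM2r ?disk_gamma_ge0// ler_nat; lia.
Qed.

Lemma dim_weight_ge0 p q : 0 <= dim_weight al p q :> R.
Proof.
apply: mulr_ge0; first by rewrite divr_ge0.
by apply: mulr_ge0; exact: disk_gamma_ge0.
Qed.

Lemma dim_weight_le p q :
  dim_weight al p q <= (p.+1%:R * disk_gamma al p) * (q.+1%:R * disk_gamma al q) :> R.
Proof.
rewrite /dim_weight [X in _ <= X]mulrACA ler_wpM2r//.
  by apply: mulr_ge0; exact: disk_gamma_ge0.
rewrite ler_pdivrMr ?ltr0n// -!natrM ler_nat.
nia.
Qed.

(** After [dim_weight_le] the index [p] carries [(p + 1)^2] and [q] carries [q + 1]: two steps of
    [disk_gammaS_ge] and one, whence the exponents [al + 2] and [al + 1]. *)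
Lemma weight_sum_le (rho : R) N : 0 <= rho -> rho < 1 ->
  \sum_(p < N) \sum_(q < N) dim_weight al p q * p.+1%:R * rho ^+ (p + q) <=
  (al%:R * al.+1%:R * (1 - rho) ^- al.+2) * (al%:R * (1 - rho) ^- al.+1).
Proof.
move=> rho0 rho1.
have A : \sum_(p < N) p.+1%:R * (p.+1%:R * disk_gamma al p) * rho ^+ p <=
    al%:R * al.+1%:R * (1 - rho) ^- al.+2.
  apply: (@le_trans _ _ (al%:R * al.+1%:R * \sum_(p < N) disk_gamma al.+2 p * rho ^+ p)).
    rewrite mulr_sumr; apply: ler_sum => p _; rewrite [X in _ <= X]mulrA ler_wpM2r ?exprn_ge0//.
    rewrite -[X in _ <= X]mulrA; apply: (@le_trans _ _ (al%:R * (p.+1%:R * disk_gamma al.+1 p))).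
      by rewrite [X in _ <= X]mulrCA ler_wpM2l// disk_gammaS_ge.
    by rewrite ler_wpM2l// disk_gammaS_ge.
  by rewrite ler_wpM2l ?mulr_ge0// binomial_sum_le.
have B : \sum_(q < N) (q.+1%:R * disk_gamma al q) * rho ^+ q <= al%:R * (1 - rho) ^- al.+1.
  apply: (@le_trans _ _ (al%:R * \sum_(p < N) disk_gamma al.+1 p * rho ^+ p)).
    rewrite mulr_sumr; apply: ler_sum => p _; rewrite [X in _ <= X]mulrA ler_wpM2r ?exprn_ge0//.
    by rewrite disk_gammaS_ge.
  by rewrite ler_wpM2l// binomial_sum_le.
apply: le_trans (ler_pM _ _ A B); last 2 first.
- apply: sumr_ge0 => p _; apply: mulr_ge0; last by rewrite exprn_ge0.
  by do 2!(apply: mulr_ge0 => //); exact: disk_gamma_ge0.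
- apply: sumr_ge0 => p _; apply: mulr_ge0; last by rewrite exprn_ge0.
  by apply: mulr_ge0 => //; exact: disk_gamma_ge0.
rewrite mulr_suml; apply: ler_sum => p _; rewrite mulr_sumr; apply: ler_sum => q _.
rewrite exprD [X in X <= _]mulrA.
have -> : p.+1%:R * (p.+1%:R * disk_gamma al p) * rho ^+ p * (q.+1%:R * disk_gamma al q * rho ^+ q)
  = (p.+1%:R * disk_gamma al p) * (q.+1%:R * disk_gamma al q) * p.+1%:R * rho ^+ p * rho ^+ q by ring.
by rewrite !ler_wpM2r ?exprn_ge0// dim_weight_le.
Qed.

End WeightBound.

Section Morphisms.
Context (K L : numFieldType) (f : {rmorphism K -> L}).

Lemma rmorph_pochhammer (m k : nat) : f (pochhammer m%:R k) = pochhammer m%:R k.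
Proof.
by rewrite /pochhammer rmorph_prod; apply: eq_bigr => j _; rewrite rmorphD !rmorph_nat.
Qed.

Lemma rmorph_dim_weight al p q : f (dim_weight al p q) = dim_weight al p q.
Proof.
rewrite /dim_weight /disk_gamma !rmorphM !fmorphV !rmorph_nat.
by rewrite !rmorph_pochhammer.
Qed.

Lemma rmorph_euler_coef al p q k : f (euler_coef al p q k) = euler_coef al p q k.
Proof. by rewrite /euler_coef !rmorphM fmorphV !rmorphM !rmorph_nat. Qed.

End Morphisms.

(** The total degree of the first term cut off in [sum_diagonals]. *)
Lemma leq_square_tail p q N : (p < N)%N -> (q < N)%N ->
  (N <= p + q + 2 * (N - maxn p q))%N.
Proof. lia. Qed.

Definition grid N : {fset nat * nat} :=
  seq_fset tt [seq (p, q) | p <- iota 0 N, q <- iota 0 N].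

Lemma in_grid N x : (x \in grid N) = (x.1 < N)%N && (x.2 < N)%N.
Proof.
rewrite seq_fsetE; case: x => p q; apply/allpairsP/idP => [[[a b]]|] /=.
  by rewrite !mem_iota !add0n => -[/andP[_ aN] /andP[_ bN] [-> ->]]; rewrite aN bN.
by move=> /andP[pN qN]; exists (p, q); split; rewrite ?mem_iota ?add0n.
Qed.

Lemma sum_grid (V : nmodType) (F : nat * nat -> V) N :
  \sum_(x <- grid N) F x = \sum_(p < N) \sum_(q < N) F (p : nat, q : nat).
Proof.
have u : uniq [seq (p, q) | p <- iota 0 N, q <- iota 0 N].
  by apply: allpairs_uniq => [||[a b] [c d]//]; rewrite iota_uniq.
rewrite (perm_big _ (seq_fset_perm tt _)) (undup_id u) big_allpairs_dep/=.
have e (f : nat -> V) : \sum_(p <- iota 0 N) f p = \sum_(p < N) f p.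
  by rewrite -(big_mkord xpredT) /index_iota subn0.
by rewrite e; apply: eq_bigr => p _; rewrite e.
Qed.

Lemma fset_sub_grid (B : {fset nat * nat}) : exists M, (B `<=` grid M)%fset.
Proof.
exists (\sum_(x <- B) (x.1 + x.2)).+1%N; apply/fsubsetP => x xB.
rewrite in_grid !ltnS (big_fsetD1 x xB)/=.
by rewrite -!addnA leq_addr addnCA leq_addr.
Qed.

(** * Quantitative error of the partial sums *)

Section PoissonEstimate.
Context {R : realType} {C : numClosedFieldType} (io : {rmorphism R -> C}).
Hypothesis io_le : {mono io : x y / x <= y}.
Variables (al : nat) (r rho : R).
Hypothesis al_gt0 : (0 < al)%N.
Hypotheses (r_ge0 : 0 <= r) (r_lt : r < rho) (rho_lt1 : rho < 1).
Local Notation n := al.+1.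
Local Notation theta := (r / rho).

Let rho_gt0 : 0 < rho. Proof. exact: le_lt_trans r_lt. Qed.
Let r_lt1 : r < 1. Proof. exact: lt_trans rho_lt1. Qed.
Let theta_ge0 : 0 <= theta. Proof. by rewrite divr_ge0// ltW. Qed.
Let theta_le1 : theta <= 1. Proof. by rewrite ler_pdivrMr// mul1r ltW. Qed.
Let r2_ge0 : 0 <= r ^+ 2. Proof. by rewrite exprn_ge0. Qed.
Let r2_lt1 : r ^+ 2 < 1. Proof. by rewrite exprn_ilt1. Qed.
Let rho2_gt0 : 0 < rho ^+ 2. Proof. by rewrite exprn_gt0. Qed.
Let rho2_lt1 : rho ^+ 2 < 1. Proof. by rewrite exprn_ilt1// ltW. Qed.

Let io_ge0 x : (0 <= io x) = (0 <= x). Proof. by rewrite -(rmorph0 io) io_le. Qed.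

Let norm_io x : 0 <= x -> `|io x| = io x.
Proof. by move=> x0; rewrite ger0_norm// io_ge0. Qed.

(** Stated over an abstract closed field, whose norm takes values in the field itself; [io] embeds
    the real quantities. *)
Definition expansion_term p q (w : C) : C :=
  io (dim_weight al p q) * io (Snpq n p q r) * disk al w w^*%R p q.

Let ratio p q (x : R) : R :=
  hyp2F1 p%:R q%:R (p + q + n)%:R x / gauss_const al p q.

Lemma hyp2F1_ratio_bounds p q x : 0 <= x -> x <= 1 -> 0 <= ratio p q x <= 1.
Proof.
move=> x0 x1; have [cF FG] := hyp2F1_cvg al p q x0 x1.
have G0 := @gauss_const_gt0 R al p q.
rewrite /ratio ler_pdivrMr// mul1r FG andbT divr_ge0 ?(ltW G0)//.
have t0 k : 0 <= hyp2F1_term p%:R q%:R (p + q + n)%:R x k by exact: hyp2F1_term_ge0.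
by apply: le_trans (series_ge0_le_lim 0 t0 cF); rewrite seriesEord/= big_ord0.
Qed.

Lemma Snpq_bounds p q : 0 <= Snpq n p q r <= r ^+ (p + q).
Proof.
rewrite SnpqE//; have /andP[h0 h1] := hyp2F1_ratio_bounds p q r2_ge0 (ltW r2_lt1).
by rewrite mulr_ge0 ?exprn_ge0//= -[X in _ <= X]mulr1 ler_wpM2l ?exprn_ge0.
Qed.

Let euler_sum p q : R := limn (series (fun k => euler_coef al p q k * (r ^+ 2) ^+ k)).

Let SnpqE' p q : Snpq n p q r = (1 - r ^+ 2) ^+ n * (r ^+ (p + q) * euler_sum p q).
Proof.
rewrite /euler_sum (cvg_lim _ (@euler_transform R al p q _ r2_ge0 r2_lt1))// SnpqE//.
by rewrite [RHS]mulrCA mulVKf// expf_neq0// subr_eq0 eq_sym lt_eqF.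
Qed.

Let euler_coef_ge0 p q k : 0 <= euler_coef al p q k :> R.
Proof. by rewrite /euler_coef divr_ge0 ?mulr_ge0. Qed.

(** At [rho^2] the whole series is at most [(1 - rho^2)^(-n)], whatever [p] and [q], by
    [euler_transform] and the bound [1] on the quotient. Comparing [r^2] with [rho^2] gains
    [theta^2] per index. *)
Let euler_tail p q m :
  0 <= euler_sum p q - \sum_(k < m) euler_coef al p q k * (r ^+ 2) ^+ k
    <= theta ^+ (2 * m) * (1 - rho ^+ 2) ^- n.
Proof.
have B N : series (fun k => euler_coef al p q k * (rho ^+ 2) ^+ k) N <= (1 - rho ^+ 2) ^- n.
  have e := @euler_transform R al p q _ (ltW rho2_gt0) rho2_lt1.
  have /andP[h0 h1] := hyp2F1_ratio_bounds p q (ltW rho2_gt0) (ltW rho2_lt1).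
  have B0 : 0 <= (1 - rho ^+ 2) ^- n.
    by rewrite invr_ge0 exprn_ge0// subr_ge0 ltW.
  apply: (@le_trans _ _ ((1 - rho ^+ 2) ^- n * ratio p q (rho ^+ 2))); last first.
    by rewrite -[X in _ <= X]mulr1 ler_wpM2l.
  rewrite -(cvg_lim _ e)//; apply: series_ge0_le_lim; last by apply/cvg_ex; eexists; exact: e.
  by move=> k; rewrite mulr_ge0 ?exprn_ge0// ltW.
have r2rho2 : r ^+ 2 <= rho ^+ 2 by rewrite lerXn2r ?nnegrE//; exact: ltW.
have [_] := @power_series_tail R (euler_coef al p q) _ _ _ m
  (euler_coef_ge0 p q) r2_ge0 r2rho2 rho2_gt0 B.
by rewrite -expr_div_n -exprM.
Qed.

Definition weight_bound : R :=
  (al%:R * al.+1%:R * (1 - rho) ^- al.+2) * (al%:R * (1 - rho) ^- al.+1).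

Lemma expansion_term_le p q (w : C) : `|w| <= 1 ->
  `|expansion_term p q w| <=
  io (dim_weight al p q * p.+1%:R * rho ^+ (p + q) * theta ^+ (p + q)).
Proof.
move=> w1; have /andP[S0 S1] := Snpq_bounds p q.
rewrite /expansion_term normrM -rmorphM norm_io; last by rewrite mulr_ge0 ?dim_weight_ge0.
have -> : dim_weight al p q * p.+1%:R * rho ^+ (p + q) * theta ^+ (p + q) =
    dim_weight al p q * r ^+ (p + q) * p.+1%:R.
  by rewrite -mulrA -exprMn [rho * _]mulrC divfK ?gt_eqF// mulrAC.
rewrite [X in _ <= X]rmorphM rmorph_nat ler_pM ?disk_le//.
  by rewrite io_ge0 mulr_ge0 ?dim_weight_ge0.
by rewrite io_le ler_wpM2l ?dim_weight_ge0.
Qed.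

Let binom_sum (z : C) N := \sum_(k < N) disk_gamma n k * z ^+ k.

Let phi (w : C) p q k : C :=
  io (dim_weight al p q * r ^+ (p + q) * (euler_coef al p q k * (r ^+ 2) ^+ k))
  * disk al w w^*%R p q.

Let binom_sum_prod w N :
  binom_sum (io r * w) N * binom_sum (io r * w^*%R) N =
  \sum_(p < N) \sum_(q < N) \sum_(k < N - maxn p q) phi w p q k.
Proof.
rewrite -(sum_diagonals (phi w)) /binom_sum mulr_suml; apply: eq_bigr => a _.
rewrite mulr_sumr; apply: eq_bigr => b _.
transitivity (io r ^+ (a + b) *
    (disk_gamma n a * disk_gamma n b * (w ^+ a * w^*%R ^+ b))).
  by rewrite !exprMn exprD; ring.
rewrite disk_inversion// mulr_sumr; apply: eq_bigr => k _.
have km : (k <= minn a b)%N by rewrite -ltnS.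
rewrite /phi rmorphM [io (dim_weight _ _ _ * _)]rmorphM [io (euler_coef _ _ _ _ * _)]rmorphM.
rewrite rmorph_dim_weight rmorph_euler_coef !rmorphXn.
have -> : io r ^+ (a + b) = io r ^+ (a - k + (b - k)) * io r ^+ 2 ^+ k.
  by rewrite -exprM -exprD; congr (_ ^+ _); clear -km; lia.
move: (dim_weight al _ _) (euler_coef al _ _ _) (disk _ _ _ _ _) (io r ^+ _) => D e Z x.
by move: (io r ^+ _ ^+ _) => y; ring.
Qed.

Let Kt : R := weight_bound * (1 - rho ^+ 2) ^- n.

(** By [binom_sum_prod] the two sums differ only by inner tails. With [r = rho theta], [euler_tail]
    and [leq_square_tail] extract [theta^N], and [rho^(p+q)] remains to make the weights
    summable. *)
Let partial_sum_error w N : `|w| <= 1 ->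
  `|\sum_(p < N) \sum_(q < N) expansion_term p q w
    - io ((1 - r ^+ 2) ^+ n) * (binom_sum (io r * w) N * binom_sum (io r * w^*%R) N)|
  <= io (Kt * theta ^+ N).
Proof.
move=> w1; have x0 : 0 <= (1 - r ^+ 2) ^+ n by rewrite exprn_ge0// subr_ge0 ltW.
have x1 : (1 - r ^+ 2) ^+ n <= 1.
  by rewrite exprn_ile1// ?subr_ge0 ?(ltW r2_lt1)// gerBl.
pose d p q := euler_sum p q - \sum_(k < N - maxn p q) euler_coef al p q k * (r ^+ 2) ^+ k.
have -> : \sum_(p < N) \sum_(q < N) expansion_term p q w
    - io ((1 - r ^+ 2) ^+ n) * (binom_sum (io r * w) N * binom_sum (io r * w^*%R) N)
  = \sum_(p < N) \sum_(q < N) io ((1 - r ^+ 2) ^+ n * (dim_weight al p q * r ^+ (p + q) * d p q))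
      * disk al w w^*%R p q.
  rewrite binom_sum_prod mulr_sumr -sumrB; apply: eq_bigr => p _.
  rewrite mulr_sumr -sumrB; apply: eq_bigr => q _.
  rewrite /expansion_term SnpqE' /phi -mulr_suml -rmorph_sum -mulr_sumr.
  rewrite /d; move: (dim_weight al p q) (disk _ _ _ _ _) (\sum_(_ < _) _) => D Z S.
  by rewrite !(rmorphM, rmorphB); ring.
apply: (@le_trans _ _ (\sum_(p < N) \sum_(q < N)
   io (dim_weight al p q * p.+1%:R * rho ^+ (p + q) * (theta ^+ N * (1 - rho ^+ 2) ^- n)))).
  apply: le_trans (ler_norm_sum _ _ _) _; apply: ler_sum => p _.
  apply: le_trans (ler_norm_sum _ _ _) _; apply: ler_sum => q _.
  have /andP[d0 d1] := euler_tail p q (N - maxn p q).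
  have D0 : 0 <= dim_weight al p q * r ^+ (p + q) * d p q.
    by rewrite mulr_ge0// mulr_ge0 ?dim_weight_ge0 ?exprn_ge0.
  rewrite normrM norm_io; last by rewrite mulr_ge0.
  apply: (@le_trans _ _ (io (dim_weight al p q * r ^+ (p + q) * d p q) * p.+1%:R)).
    rewrite ler_pM ?disk_le// ?io_ge0 ?io_le.
      by rewrite mulr_ge0.
    by rewrite ler_piMl.
  rewrite -(rmorph_nat io) -rmorphM io_le.
  suff h : r ^+ (p + q) * d p q <= rho ^+ (p + q) * (theta ^+ N * (1 - rho ^+ 2) ^- n).
    rewrite -[X in X * _]mulrA [X in X <= _]mulrAC -[X in _ <= X]mulrA.
    by rewrite ler_wpM2l// mulr_ge0 ?dim_weight_ge0.
  have -> : r ^+ (p + q) = (rho * theta) ^+ (p + q) by rewrite [rho * _]mulrC divfK ?gt_eqF.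
  rewrite exprMn -mulrA ler_wpM2l ?exprn_ge0 ?(ltW rho_gt0)//.
  apply: (@le_trans _ _ (theta ^+ (p + q) * (theta ^+ (2 * (N - maxn p q)) * (1 - rho ^+ 2) ^- n))).
    by rewrite ler_wpM2l ?exprn_ge0.
  rewrite mulrA -exprD ler_wpM2r ?invr_ge0 ?exprn_ge0 ?subr_ge0 ?(ltW rho2_lt1)//.
  by rewrite ler_wiXn2l// leq_square_tail.
have -> : \sum_(p < N) \sum_(q < N)
   io (dim_weight al p q * p.+1%:R * rho ^+ (p + q) * (theta ^+ N * (1 - rho ^+ 2) ^- n)) =
  io ((\sum_(p < N) \sum_(q < N) dim_weight al p q * p.+1%:R * rho ^+ (p + q))
    * (theta ^+ N * (1 - rho ^+ 2) ^- n)).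
  rewrite mulr_suml rmorph_sum; apply: eq_bigr => p _.
  by rewrite mulr_suml rmorph_sum.
rewrite io_le /Kt /weight_bound -[X in _ <= X]mulrA [X in _ <= _ * X]mulrC.
rewrite ler_wpM2r ?weight_sum_le ?(ltW rho_gt0)//.
by rewrite mulr_ge0 ?exprn_ge0 ?invr_ge0 ?exprn_ge0 ?subr_ge0 ?(ltW rho2_lt1).
Qed.

Definition poisson_kernel (w : C) : C :=
  io (1 - r ^+ 2) ^+ n / ((1 - io r * w) * (1 - io r * w^*%R)) ^+ n.

Lemma square_sum_error : exists2 K : C, 0 <= K & forall N w, `|w| <= 1 ->
  `|poisson_kernel w - \sum_(p < N) \sum_(q < N) expansion_term p q w| <= K * io theta ^+ N.
Proof.
have r0' : 0 <= io r by rewrite io_ge0.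
have r1' : io r < io rho by rewrite lt_neqAle io_le (ltW r_lt) andbT (inj_eq (fmorph_inj io)) lt_eqF.
have rho1' : io rho < 1 by rewrite -(rmorph1 io) lt_neqAle io_le (ltW rho_lt1) andbT (inj_eq (fmorph_inj io)) lt_eqF.
have [M M0 ME] := @binomial_series_error C n (io r) (io rho) r0' r1' rho1'.
have t0 : 0 <= io theta by rewrite io_ge0.
have t1 : io theta <= 1 by rewrite -(rmorph1 io) io_le.
have thE : io r / io rho = io theta by rewrite fmorph_div.
have ir1 : 0 < 1 - io r by rewrite subr_gt0 (lt_trans r1').
(* With [x = 1 - P^n A] and [y = 1 - Q^n B] one has [1 - P^n A Q^n B = x + y - x y], of norm at most
   [(2 M + M^2) theta^N]; the other factors come from [|P|, |Q| >= 1 - r]. *)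
pose K1 := (1 - io r) ^- n * (1 - io r) ^- n * (2 * M + M * M).
exists (K1 + io Kt).
  rewrite addr_ge0// ?mulr_ge0 ?addr_ge0 ?mulr_ge0 ?invr_ge0 ?exprn_ge0 ?(ltW ir1)//.
  rewrite io_ge0 /Kt /weight_bound !mulr_ge0 ?invr_ge0 ?exprn_ge0 ?subr_ge0 ?(ltW rho2_lt1) ?(ltW rho_lt1)//.
move=> N w w1; pose P := 1 - io r * w; pose Q := 1 - io r * w^*%R.
pose A := binom_sum (io r * w) N; pose B := binom_sum (io r * w^*%R) N.
have nw : `|io r * w| <= io r by rewrite normrM norm_io// ler_piMr.
have nw' : `|io r * w^*%R| <= io r by rewrite normrM norm_conjC norm_io// ler_piMr.
have eA : `|1 - P ^+ n * A| <= M * io theta ^+ N by rewrite -thE; exact: ME.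
have eB : `|1 - Q ^+ n * B| <= M * io theta ^+ N by rewrite -thE; exact: ME.
have lowP z : `|z| <= io r -> 1 - io r <= `|1 - z|.
  move=> zr; apply: le_trans (lerB_dist _ _).
  by rewrite normr1 lerB.
have P0 : 0 < `|P| by apply: lt_le_trans ir1 _; exact: lowP.
have Q0 : 0 < `|Q| by apply: lt_le_trans ir1 _; exact: lowP.
pose c := io ((1 - r ^+ 2) ^+ n).
have c0 : 0 <= c by rewrite io_ge0 exprn_ge0// subr_ge0 ltW.
have c1 : c <= 1.
  by rewrite -(rmorph1 io) io_le exprn_ile1// ?subr_ge0 ?(ltW r2_lt1)// gerBl.
apply: le_trans (ler_distD (c * (A * B)) _ _) _; rewrite mulrDl lerD//; last first.
  rewrite distrC -(rmorphXn io) -rmorphM; exact: partial_sum_error.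
have -> : poisson_kernel w - c * (A * B) = c / (P ^+ n * Q ^+ n) * (1 - (P ^+ n * A) * (Q ^+ n * B)).
  rewrite /poisson_kernel -/P -/Q -(rmorphXn io) -/c exprMn.
  by field; rewrite !expf_neq0 -?normr_gt0.
have tN1 : io theta ^+ N <= 1 by rewrite exprn_ile1.
have tN0 : 0 <= io theta ^+ N by rewrite exprn_ge0.
rewrite normrM /K1 -[X in _ <= X]mulrA; apply: ler_pM => //.
  rewrite normrM normfV normrM (ger0_norm c0) !normrX -invfM.
  rewrite -[X in _ <= X]mul1r; apply: ler_pM => //.
  rewrite lef_pV2 ?posrE ?mulr_gt0 ?exprn_gt0//.
  by rewrite ler_pM ?exprn_ge0 ?lerXn2r ?nnegrE ?normr_ge0 ?lowP ?(ltW ir1).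
rewrite (_ : 1 - _ = (1 - P ^+ n * A) + (1 - Q ^+ n * B)
  - (1 - P ^+ n * A) * (1 - Q ^+ n * B)); last by ring.
apply: le_trans (ler_normB _ _) _; rewrite [X in _ <= X]mulrDl lerD//.
  apply: le_trans (ler_normD _ _) _.
  by rewrite [X in _ <= X](_ : _ = M * io theta ^+ N + M * io theta ^+ N) ?lerD//; ring.
rewrite normrM -mulrA; apply: (@le_trans _ _ (M * io theta ^+ N * (M * io theta ^+ N))).
  by rewrite ler_pM.
rewrite -[X in X <= _]mulrA ler_wpM2l// mulrCA ler_wpM2l//.
by rewrite -[X in _ <= X]mulr1 ler_wpM2l.
Qed.

Variable nrm : C -> R.
Hypothesis nrmE : forall z, io (nrm z) = `|z|.

Lemma poisson_kernelE w :
  io ((1 - r ^+ 2) ^+ n / nrm (1 - io r * w) ^+ (2 * n)) = poisson_kernel w.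
Proof.
have conj_r : (io r)^*%R = io r by rewrite geC0_conj ?io_ge0.
rewrite rmorphM fmorphV !rmorphXn nrmE exprM normCK /poisson_kernel.
by rewrite [(1 - io r * w)^*%R]rmorphB rmorph1 rmorphM /= conj_r rmorphB rmorph1 rmorphXn.
Qed.

(** This makes the convergence unordered: outside the grid [p + q >= N], so any finite set of
    further terms adds at most [weight_bound * theta^N]. *)
Lemma expansion_error : exists2 K : R, 0 <= K &
  forall N (B : {fset nat * nat}) w, (grid N `<=` B)%fset -> nrm w <= 1 ->
    nrm (poisson_kernel w - partial_sum (fun x => expansion_term x.1 x.2 w) B)
    <= K * theta ^+ N.
Proof.
have [K K0 KE] := square_sum_error.
have Kn : io (nrm K) = K by rewrite nrmE ger0_norm.
have Kw0 : 0 <= weight_bound.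
  by rewrite /weight_bound !mulr_ge0 ?invr_ge0 ?exprn_ge0 ?subr_ge0 ?(ltW rho_lt1).
exists (nrm K + weight_bound); first by rewrite addr_ge0// -io_ge0 Kn.
move=> N B w gB; rewrite -io_le nrmE rmorph1 => w1.
rewrite -io_le nrmE rmorphM rmorphD Kn rmorphXn.
pose F x := expansion_term x.1 x.2 w.
pose a x : R := dim_weight al x.1 x.2 * x.1.+1%:R * rho ^+ (x.1 + x.2).
have a0 x : 0 <= a x by rewrite mulr_ge0 ?exprn_ge0 ?(ltW rho_gt0)// mulr_ge0 ?dim_weight_ge0.
have aB : \sum_(x <- B) a x <= weight_bound.
  have [M BM] := fset_sub_grid B.
  apply: (@le_trans _ _ (\sum_(x <- grid M) a x)); last first.
    by rewrite sum_grid; apply: weight_sum_le; rewrite ?(ltW rho_gt0).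
  rewrite [X in _ <= X](big_fsetID _ (mem B)) /=.
  rewrite (_ : [fset x | x in grid M & x \in B]%fset = B); last first.
    apply/fsetP => x; rewrite !inE /= andbC; case: (boolP (x \in B)) => //= xB.
    exact: (fsubsetP BM).
  by rewrite lerDl sumr_ge0.
have -> : partial_sum F B = \sum_(p < N) \sum_(q < N) expansion_term p q w
    + \sum_(x <- B | x \notin grid N) F x.
  rewrite /partial_sum -(big_seq_fsetE _ _ predT F) /= (bigID (mem (grid N)))/=.
  congr (_ + _); rewrite -(sum_grid F) [LHS]big_fset_condE.
  rewrite (_ : [fset x in B | x \in grid N]%fset = grid N)//.
  apply/fsetP => x; rewrite !inE /= andbC.
  by case: (boolP (x \in grid N)) => //= /(fsubsetP gB).
rewrite opprD addrA; apply: le_trans (ler_normB _ _) _; rewrite mulrDl lerD ?KE//.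
apply: le_trans (ler_norm_sum _ _ _) _.
rewrite -rmorphXn -rmorphM.
apply: (@le_trans _ _ (io (\sum_(x <- B) a x * theta ^+ N))); last first.
  by rewrite io_le -mulr_suml ler_wpM2r ?exprn_ge0.
rewrite rmorph_sum big_mkcond /=; apply: ler_sum => x _; case: ifPn => xN.
  apply: le_trans (expansion_term_le _ _ w1) _.
  rewrite io_le ler_wpM2l ?a0// ler_wiXn2l//.
  by move: xN; rewrite in_grid negb_and -!leqNgt => /orP[|] /leq_trans; apply; rewrite ?leq_addr ?leq_addl.
by rewrite io_ge0 mulr_ge0 ?exprn_ge0.
Qed.

End PoissonEstimate.

(** * Surface measure and the L2 norm *)

(** The integral is a supremum over simple functions below [f], each of which is almost everywhere
    at most [c]; thus [f] itself may be arbitrary. *)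
Lemma ge0_integral_le_nomeas d (T : measurableType d) (R : realType)
    (mu : probability T R) (S : set T) (f : T -> \bar R) (c : R) :
  measurable S -> mu (~` S) = 0%E -> (forall t, (0 <= f t)%E) -> 0 <= c ->
  (forall t, S t -> (f t <= c%:E)%E) -> (\int[mu]_t f t <= c%:E)%E.
Proof.
move=> mS S0 f0 c0 fc; rewrite ge0_integralTE//.
apply: ge_ereal_sup => _ [h /= hf <-]; rewrite -integralT_nnsfun.
rewrite -[leRHS]mule1 -(@probability_setT _ _ _ mu) -integral_cst//.
apply: ae_ge0_le_integral => //.
- by move=> t _; rewrite lee_fin; exact: fun_ge0.
- by apply/measurable_EFinP; exact: measurable_funTS.
exists (~` S); split; [exact: measurableC|by []|].
apply: subsetC => t St _ /=; apply: le_trans (hf t) _; exact: fc.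
Qed.

Lemma normc_ge0 (R : rcfType) (x : R[i]) : 0 <= normc x.
Proof. by case: x => a b; exact: sqrtr_ge0. Qed.

Section SphereMeasure.
Context {R : realType}.

(** Boxes fit the inductive construction of [lebesgue_Rn]. They are used around the unit ball,
    inside it, and, degenerate, as the origin. *)
Definition cube (a b : R) m : set (Rn R m) := [set t | forall i, a <= tnth t i <= b].

Lemma cubeS a b m :
  cube a b (m := m.+1) = @Rn_uncons R m @^-1` (`[a, b]%classic `*` cube a b (m := m)).
Proof.
apply/seteqP; split => t /= h.
  split => /=; first by rewrite in_itv/= h.
  by move=> i /=; rewrite tnth_behead.
move=> i; case: h => /= h0 h1; have [j ->|->] := unliftP ord0 i; last by move: h0; rewrite in_itv.
have := h1 j; rewrite tnth_behead (_ : inord j.+1 = lift ord0 j)//.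
by apply: val_inj; rewrite /= inordK// ltnS; exact: ltn_ord.
Qed.

Lemma measurable_cube a b m : measurable (cube a b (m := m)).
Proof.
elim: m => [|m IH].
  by rewrite (_ : cube a b (m := _) = setT)//; apply/seteqP; split => // t _ [].
rewrite cubeS -[X in measurable X]setTI; apply: measurable_Rn_uncons => //.
by apply: measurableX => //; exact: measurable_itv.
Qed.

Lemma cube_volume a b m : a <= b ->
  lebesgue_Rn m (cube a b (m := m)) = ((b - a) ^+ m)%:E.
Proof.
move=> ab; elim: m => [|m IH].
  rewrite (_ : cube a b (m := _) = setT); last by apply/seteqP; split => // t _ [].
  by rewrite /= diracT expr0.
rewrite /= /lebesgue_step /pushforward cubeS -comp_preimage.
rewrite (_ : _ \o _ = id); last by apply/funext => x; exact: Rn_consK.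
rewrite preimage_id product_measure1E//; last exact: measurable_cube.
have e : lebesgue_measure `[a, b]%classic = (b - a)%:E.
  rewrite lebesgue_measure_itv/= lte_fin; case: ltP => [_|ba]; first by rewrite EFinB.
  by rewrite (_ : b = a) ?subrr//; apply/eqP; rewrite eq_le ab ba.
rewrite exprS EFinM; congr (_ * _)%E; [exact: e|exact: IH].
Qed.

Lemma enorm_ge0 m (t : Rn R m) : 0 <= enorm t.
Proof. exact: sqrtr_ge0. Qed.

Lemma sqr_enorm m (t : Rn R m) : enorm t ^+ 2 = \sum_(i < m) tnth t i ^+ 2.
Proof. by rewrite sqr_sqrtr// sumr_ge0// => i _; rewrite sqr_ge0. Qed.

Lemma uball_volume_lty m : (lebesgue_Rn m (@uball R m) < +oo)%E.
Proof.
apply: (@le_lt_trans _ _ (lebesgue_Rn m (cube (-1) 1 (m := m)))); last first.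
  by rewrite cube_volume ?ltry// lerNl opprK ler1n.
apply: le_measure; rewrite ?inE; [exact: measurable_uball|exact: measurable_cube|].
move=> t /= t1 i; rewrite -ler_norml -(@ler_pXn2r _ 2) ?nnegrE// expr1n real_normK ?num_real//.
apply: le_trans (_ : enorm t ^+ 2 <= 1); last by rewrite exprn_ile1// enorm_ge0.
by rewrite sqr_enorm (bigD1 i)//= lerDl sumr_ge0// => j _; rewrite sqr_ge0.
Qed.

Lemma uball_volume_gt0 m : (0 < lebesgue_Rn m (@uball R m))%E.
Proof.
have m0 : 0 < m.+1%:R^-1 :> R by rewrite invr_gt0.
(* A box of side [1 / (m + 1)] lies in the ball, since [m] squares of such numbers sum to at most
   [1]. *)
apply: (@lt_le_trans _ _ (lebesgue_Rn m (cube 0 m.+1%:R^-1 (m := m)))).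
  by rewrite cube_volume ?(ltW m0)// subr0 lte_fin exprn_gt0.
apply: le_measure; rewrite ?inE; [exact: measurable_cube|exact: measurable_uball|].
move=> t /= t1; rewrite /uball /= -(@ler_pXn2r _ 2) ?nnegrE ?enorm_ge0// expr1n sqr_enorm.
apply: (@le_trans _ _ (\sum_(i < m) m.+1%:R^-1)).
  apply: ler_sum => i _; have /andP[h0 h1] := t1 i.
  apply: (@le_trans _ _ (m.+1%:R^-1 ^+ 2)); first by rewrite lerXn2r ?nnegrE// ltW.
  by rewrite expr2 ler_piMl ?(ltW m0)// invf_le1 ?ler1n.
by rewrite sumr_const card_ord -[_ *+ m]mulr_natr mulrC ler_pdivrMr// mul1r ler_nat.
Qed.

Definition unit_sphere m : set (Rn R m) := [set t | enorm t = 1].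

Lemma measurable_unit_sphere m : measurable (@unit_sphere m).
Proof.
rewrite -[X in measurable X]setTI -[@unit_sphere m]/(@enorm R m @^-1` [set 1]).
by apply: measurable_enorm => //; exact: measurable_set1.
Qed.

Lemma radial_proj_norm m (t : Rn R m) : enorm t != 0 -> enorm (radial_proj t) = 1.
Proof.
move=> t0; apply/eqP; rewrite -(@eqrXn2 _ 2) ?enorm_ge0// expr1n sqr_enorm.
under eq_bigr do rewrite tnth_mktuple expr_div_n.
by rewrite -mulr_suml -sqr_enorm mulfV// expf_neq0.
Qed.

(** [radial_proj] sends every vector of nonzero norm to the sphere, so the bad set lies in the
    origin, a null box for [m > 0]. The ball has positive finite volume, so [mnormalize] really
    divides by it. *)
Lemma surface_measure_sphere m : (0 < m)%N ->
  surface_measure m (~` @unit_sphere m) = 0%E :> \bar R.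
Proof.
move=> m0.
have enorm0 : enorm ([tuple of nseq m 0] : Rn R m) = 0.
  rewrite /enorm big1 ?sqrtr0// => i _.
  by rewrite tnth_nseq expr0n.
have z0 : lebesgue_Rn m (cube 0 0 (m := m)) = 0%E.
  by rewrite cube_volume// subrr expr0n gtn_eqF.
have tot : cone_volume [set: Rn R m] = lebesgue_Rn m (@uball R m).
  by rewrite /cone_volume /= /pushforward /mrestr preimage_setT setTI.
have Cz : cone_volume (~` @unit_sphere m) = 0%E.
  rewrite /cone_volume /= /pushforward /mrestr.
  apply: (@subset_measure0 _ _ _ (lebesgue_Rn m) _ (cube 0 0 (m := m))).
  - apply: measurableI; last exact: measurable_uball.
    rewrite -[X in measurable X]setTI; apply: measurable_radial_proj => //.
    by apply: measurableC; exact: measurable_unit_sphere.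
  - exact: measurable_cube.
  - move=> t [/= nS _] i; have [t0|t0] := eqVneq (enorm t) 0; last first.
      by exfalso; apply: nS; exact: radial_proj_norm.
    suff -> : tnth t i = 0 by rewrite lexx.
    have /eqP : \sum_(i < m) tnth t i ^+ 2 = 0 by rewrite -sqr_enorm t0 expr0n.
    rewrite psumr_eq0 => [/allP/(_ i)|j _]; last by rewrite sqr_ge0.
    by rewrite mem_index_enum sqrf_eq0 => /(_ isT)/eqP.
  - exact: z0.
rewrite /surface_measure /= /mnormalize.
have [V0 Voo] := (uball_volume_gt0 m, uball_volume_lty m).
rewrite -tot in V0 Voo.
rewrite ifF.
  by apply/eqP; rewrite mule_eq0; apply/orP; left; apply/eqP; exact: Cz.
by apply/negP => /orP[/eqP e|/eqP e]; [move: V0|move: Voo]; rewrite e ltxx.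
Qed.

Lemma Cn_of_R2n_sphere n (t : Rn R (n + n)) :
  unit_sphere t -> usphere (Cn_of_R2n t).
Proof.
rewrite /unit_sphere /usphere /= => <-; rewrite /hnorm /enorm; congr (Num.sqrt _).
rewrite big_split_ord/= -big_split/= /hdot (raddf_sum (@complex.Re R : Rcomplex R -> R)).
apply: eq_bigr => j _; rewrite !mxE /=.
by rewrite mulrN opprK -!expr2.
Qed.

Lemma L2norm_le n (f : 'rV[R[i]]_n -> R[i]) (e : R) : (0 < n)%N -> 0 <= e ->
  (forall xi, usphere xi -> normc (f xi) <= e) -> (L2norm f <= e%:E)%E.
Proof.
move=> n0 e0 fe.
have S0 : surface_measure (n + n) (~` @unit_sphere (n + n)) = 0%E :> \bar R.
  by apply: surface_measure_sphere; rewrite addn_gt0 n0.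
pose I := (\int[surface_measure (n + n)]_t
  (`|normc (f (Cn_of_R2n t))| `^ 2)%:E)%E.
rewrite /L2norm unlock -[X in (X `^ _ <= _)%E]/I.
have I0 : (0 <= I)%E by apply: integral_ge0 => t _; rewrite lee_fin powR_ge0.
have Ie : (I <= (e ^+ 2)%:E)%E.
  apply: (ge0_integral_le_nomeas (@measurable_unit_sphere (n + n)) S0).
  - by move=> t; rewrite lee_fin powR_ge0.
  - by rewrite exprn_ge0.
  move=> t St; rewrite lee_fin -powR_mulrn// ge0_ler_powR ?nnegrE//.
  by rewrite ger0_norm ?normc_ge0// fe//; exact: Cn_of_R2n_sphere.
have -> : e%:E = ((e ^+ 2)%:E `^ 2^-1)%E.
  by rewrite poweR_EFin -powR_mulrn// -powRrM mulfV ?powRr1.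
by apply: gt0_ler_poweR; rewrite ?in_itv/= ?I0 ?leey ?lee_fin ?exprn_ge0.
Qed.

End SphereMeasure.

(** * The expansion *)

(** The squared norm of [xi - (xi | eta) eta] is [1 - |(xi | eta)|^2]. *)
Lemma cauchy_schwarz_usphere (R : realType) n (xi eta : 'rV[R[i]]_n) :
  usphere xi -> usphere eta -> normc (hdot xi eta) <= 1.
Proof.
move=> /usphere_hdot xi1 /usphere_hdot eta1.
have swap : hdot eta xi = Num.conj (hdot xi eta).
  rewrite /hdot rmorph_sum; apply: eq_bigr => j _.
  by rewrite rmorphM /= mulrC; congr (_ * _); rewrite conjCK.
pose w := hdot xi eta.
have e : hdot (xi - w *: eta) (xi - w *: eta) =
    hdot xi xi - Num.conj w * hdot xi eta - w * hdot eta xi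
    + w * Num.conj w * hdot eta eta.
  rewrite /hdot !mulr_sumr -!sumrB -big_split; apply: eq_bigr => j _.
  by rewrite !mxE rmorphB rmorphM /=; ring.
have : 0 <= hdot (xi - w *: eta) (xi - w *: eta).
  by apply: sumr_ge0 => j _; rewrite mul_conjC_ge0.
rewrite e xi1 eta1 swap -/w mulr1 addrNK [_ * w]mulrC -normCK subr_ge0.
rewrite expr_le1// => h.
by rewrite -lecR.
Qed.

Lemma expansion_termE (R : realType) al (r : R) p q (eta xi : 'rV[R[i]]_al.+1) :
  (0 < al)%N ->
  (subspace_dim (@calH R al.+1 p q))%:R * (Snpq al.+1 p q r)%:C * zonal p q eta xi =
  expansion_term (real_complex R) al r p q (hdot xi eta).
Proof.
move=> al0; rewrite dim_calH// zonalE//.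
by rewrite -(rmorph_dim_weight (real_complex R)).
Qed.

Lemma hnormZ (R : realType) n (r : R) (xi : 'rV[R[i]]_n) : 0 <= r ->
  usphere xi -> hnorm (r%:C *: xi) = r.
Proof.
move=> r0 /usphere_hdot xi1; rewrite /hnorm.
have -> : hdot (r%:C *: xi) (r%:C *: xi) = (r ^+ 2)%:C.
  transitivity (r%:C * r%:C * hdot xi xi).
    rewrite hdotZl /hdot !mulr_sumr; apply: eq_bigr => j _.
    by rewrite !mxE rmorphM /= [Num.conj r%:C]conjc_real; ring.
  by rewrite xi1 mulr1 -rmorphM.
by rewrite sqrtr_sqr ger0_norm.
Qed.

Lemma poisson_szegoE (R : realType) n (r : R) (xi eta : 'rV[R[i]]_n) : 0 <= r ->
  usphere xi -> poisson_szego (r%:C *: xi) eta =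
    (1 - r ^+ 2) ^+ n / normc (1 - r%:C * hdot xi eta) ^+ (2 * n).
Proof. by move=> r0 xi1; rewrite /poisson_szego hnormZ// hdotZl. Qed.

#[local] Existing Instance totally_filter.

Section Expansion.
Context {R : realType} (al : nat) (r : R) (eta : 'rV[R[i]]_al.+1).
Hypotheses (al_gt0 : (0 < al)%N) (r_ge0 : 0 <= r) (r_lt1 : r < 1).
Hypothesis eta_S : usphere eta.

Let u (pq : nat * nat) (xi : 'rV[R[i]]_al.+1) : R[i] :=
  (subspace_dim (@calH R al.+1 pq.1 pq.2))%:R * (Snpq al.+1 pq.1 pq.2 r)%:C
  * zonal pq.1 pq.2 eta xi.

Lemma expansion_uniform (e : R) : 0 < e ->
  exists A : {fset nat * nat}, forall B xi, (A `<=` B)%fset -> usphere xi ->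
    normc ((poisson_szego (r%:C *: xi) eta)%:C - partial_sum (u ^~ xi) B) <= e.
Proof.
move=> e0; pose rho := (r + 1) / 2.
have r_rho : r < rho by rewrite (midf_lt r_lt1).
have rho1 : rho < 1 by rewrite (midf_lt r_lt1).
have rho0 : 0 < rho by exact: le_lt_trans r_rho.
have nE (z : R[i]) : real_complex R (normc z) = `|z| by [].
have [K K0 KE] := @expansion_error R R[i] (real_complex R) (@lecR R) al r rho
  al_gt0 r_ge0 r_rho rho1 (@normc R) nE.
have th0 : 0 <= r / rho by rewrite divr_ge0// ltW.
have th : `|r / rho| < 1 by rewrite ger0_norm// ltr_pdivrMr// mul1r.
have [N _ hN] : \forall N \near \oo, `|K * (r / rho) ^+ N| <= e.
  have /cvgr0Pnorm_le/(_ _ e0) : (fun N => K * (r / rho) ^+ N) @ \oo --> (0 : R).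
    by rewrite -(mulr0 K); apply: cvgMr; exact: cvg_expr.
  by [].
exists (grid N) => B xi gB xi1.
have := KE N B (hdot xi eta) gB (cauchy_schwarz_usphere xi1 eta_S).
rewrite -(poisson_kernelE (@lecR R) _ _ nE)// -poisson_szegoE//.
rewrite (_ : partial_sum _ B = partial_sum (u ^~ xi) B); last first.
  by apply: eq_bigr => x _; rewrite /u expansion_termE.
move/le_trans; apply; apply: le_trans (hN N _); last exact: leqnn.
exact: ler_norm.
Qed.

Lemma expansion_pointwise xi : usphere xi ->
  has_sum (u ^~ xi) (poisson_szego (r%:C *: xi) eta)%:C.
Proof.
move=> xi1; apply/cvgr0Pnorm_le => e e0.
have [A AE] := expansion_uniform e0.
exists A => // B /= AB; rewrite ger0_norm ?normc_ge0//.
exact: AE.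
Qed.

Lemma expansion_L2 : spherical_expansion
  (fun xi => (poisson_szego (r%:C *: xi) eta)%:C) u.
Proof.
split=> [p q|]; first exact: zonal_sphH.
have L2 e : 0 < e -> \forall B \near totally,
    (0 <= L2norm (fun xi => ((poisson_szego (r%:C *: xi) eta)%:C
      - partial_sum (u ^~ xi) B)%R) <= e%:E)%E.
  move=> e0; have [A AE] := expansion_uniform e0.
  exists A => // B /= AB; rewrite Lnorm_ge0 L2norm_le ?ltW//.
  by move=> xi xi1; exact: AE.
apply/fine_cvgP; split.
  (* Convergence in [\bar R] first asks that the norms be eventually finite; the bound with [e = 1]
     provides it. *)
  have := L2 1 ltr01; apply: filterS => B /andP[h0 h1].
  by rewrite ge0_fin_numE// (le_lt_trans h1)// ltry.
apply/cvgr0Pnorm_le => e e0; have := L2 e e0; apply: filterS => B /= /andP[h0 h1].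
by rewrite ger0_norm ?fine_ge0// -lee_fin fineK// ge0_fin_numE// (le_lt_trans h1)// ltry.
Qed.

End Expansion.

Theorem theorem3 (R : realType) (n : nat) (r : R) (eta : 'rV[R[i]]_n)
    (n_ge2 : (2 <= n)%N) (r_ge0 : 0 <= r) (r_lt1 : r < 1)
    (eta_S : usphere eta) :
  [/\ forall xi : 'rV[R[i]]_n, usphere xi ->
        poisson_szego (r%:C *: xi) eta =
          (1 - r ^+ 2) ^+ n / normc (1 - r%:C * hdot xi eta) ^+ (2 * n),
      spherical_expansion
        (fun xi => (poisson_szego (r%:C *: xi) eta)%:C)
        (fun pq xi => (subspace_dim (@calH R n pq.1 pq.2))%:R
                      * (Snpq n pq.1 pq.2 r)%:C * zonal pq.1 pq.2 eta xi),
      forall xi : 'rV[R[i]]_n, usphere xi ->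
        has_sum
          (fun pq : nat * nat => (subspace_dim (@calH R n pq.1 pq.2))%:R
                      * (Snpq n pq.1 pq.2 r)%:C * zonal pq.1 pq.2 eta xi)
          (poisson_szego (r%:C *: xi) eta)%:C,
      forall p q : nat, cvgn (series (Snpq_term n p q r)) &
      forall p q : nat,
        [/\ cvgn (series (hyp2F1_term p%:R q%:R (p + q + n)%:R (r ^+ 2))),
            cvgn (series (hyp2F1_term p%:R q%:R (p + q + n)%:R (1 : R))),
            hyp2F1 p%:R q%:R (p + q + n)%:R (1 : R) != 0 &
            Snpq n p q r =
              r ^+ (p + q) * (hyp2F1 p%:R q%:R (p + q + n)%:R (r ^+ 2)
                              / hyp2F1 p%:R q%:R (p + q + n)%:R 1)]].
Proof.
case: n eta n_ge2 eta_S => [//|al] eta al_gt0 eta_S.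
have r2_ge0 : 0 <= r ^+ 2 by rewrite exprn_ge0.
have r2_le1 : r ^+ 2 <= 1 by rewrite exprn_ile1// ltW.
split.
- by move=> xi; exact: poisson_szegoE.
- exact: expansion_L2.
- by move=> xi xi_S; exact: expansion_pointwise.
- by move=> p q; apply/cvg_ex; eexists; exact: Snpq_term_cvg.
- move=> p q; have h1 := @hyp2F1_at1_cvg R al p q.
  have F1 : hyp2F1 p%:R q%:R (p + q + al.+1)%:R (1 : R) = gauss_const al p q.
    exact: cvg_lim h1.
  split; [exact: (hyp2F1_cvg al p q r2_ge0 r2_le1).1| | |].
  + by apply/cvg_ex; eexists; exact: h1.
  + by rewrite F1 gt_eqF// gauss_const_gt0.
  + by rewrite F1 SnpqE.
Qed.
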